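(* There are exactly ten $\mathbb{Z}[\sqrt2]$-PCFs for $\sqrt{2+\sqrt2}$ of type $(1,2)$. They are $$\begin{aligned}\sqrt{2+\sqrt2}&=[1+\sqrt2,\ \overline{-2,\ 2+2\sqrt2}]\\&=[1,\ \overline{2\sqrt2-2,\ 2}]\\&=[-1+2\sqrt2,\ \overline{26+18\sqrt2,\ -2+4\sqrt2}]\\&=[5+3\sqrt2,\ \overline{62-44\sqrt2,\ 10+6\sqrt2}]\\&=[\sqrt2,\ \overline{2,\ 2\sqrt2}]\\&=[2+\sqrt2,\ \overline{2-2\sqrt2,\ 4+2\sqrt2}]\\&=[2,\ \overline{-4-2\sqrt2,\ 4}]\\&=[2+2\sqrt2,\ \overline{8-6\sqrt2,\ 4+4\sqrt2}]\\&=[-182+130\sqrt2,\ \overline{-123656-87438\sqrt2,\ -364+260\sqrt2}]\\&=[442+312\sqrt2,\ \overline{-298532+211094\sqrt2,\ 884+624\sqrt2}].\end{aligned}$$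
   Context: A $\mathbb{Z}[\sqrt2]$-PCF of type $(1,2)$ of a number $\beta$ is a periodic continued fraction $[b_1,\overline{a_1,a_2}]$, with $(b_1,a_1,a_2)\in\mathbb{Z}[\sqrt2]^3$, whose value is $\beta$. Here $[b_1,\overline{a_1,a_2}]$ is the infinite continued fraction with partial quotients $c_1,c_2,\ldots$ equal to $b_1,a_1,a_2,a_1,a_2,\ldots$. With $D(c)=\begin{bmatrix}c&1\\1&0\end{bmatrix}$, its $n$-th convergent is $M_{11}/M_{21}\in\mathbb{P}^1(\mathbb{C})$ where $M=D(c_1)\cdots D(c_n)$ (i.e. the usual finite continued fraction $[c_1,\ldots,c_n]$), and its value is the limit of the convergents in $\mathbb{P}^1(\mathbb{C})$, if it exists. *)

(* Defs.v *)
From HB Require Import structures.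
From mathcomp Require Import all_boot all_order all_algebra complex.
From mathcomp Require Import all_classical all_reals all_analysis.

Set Implicit Arguments.
Unset Strict Implicit.
Unset Printing Implicit Defensive.

Import Order.TTheory GRing.Theory Num.Theory numFieldNormedType.Exports.

Local Open Scope classical_set_scope.
Local Open Scope ring_scope.

(* P^1(C) as the Riemann sphere C u {oo}; its topology is built on that of
   [R[i]^o], the copy of [R[i]] carrying the topology of the norm. *)
Definition P1 (R : realType) : topologicalType :=
  one_point_compactification (R[i]^o).

(* The point with homogeneous coordinates [x : y], for (x, y) <> (0, 0);
   [None] is the point at infinity. *)
Definition P1_of_coords (R : realType) (x y : R[i]) : P1 R :=
  if y == 0 then None else Some (x / y).

Definition P1_of_C (R : realType) (z : R[i]) : P1 R := Some z.

Definition D (R : realType) (c : R[i]) : 'M[R[i]]_2 :=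
  \matrix_(i, j) if (i == 0) && (j == 0) then c else (i != j)%:R.

(* Sequences are indexed from 0, so the partial quotient written c_n in the
   usual 1-based numbering is [c n.-1]. The matrix M below has determinant 1 or
   -1, so its first column is nonzero and defines a point of P^1(C). *)
Definition convergent (R : realType) (c : nat -> R[i]) (n : nat) : P1 R :=
  let M := \prod_(i < n) D (c i) in P1_of_coords (M 0 0) (M 1 0).

Definition has_value (R : realType) (c : nat -> R[i]) (p : P1 R) : Prop :=
  convergent c @ \oo --> p.

Definition pcf12 (R : realType) (b1 a1 a2 : R[i]) (n : nat) : R[i] :=
  if n == 0%N then b1 else if odd n then a1 else a2.

Definition zsqrt2 (R : realType) (m n : int) : R[i] :=
  m%:~R + n%:~R * sqrtC 2.

Definition Zsqrt2 (R : realType) : set R[i] :=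
  [set x | exists m n : int, x = zsqrt2 R m n].

(* The Z[sqrt 2]-PCFs of type (1,2) for beta: a PCF is the formal expression,
   given by its coefficients (b1, a1, a2). *)
Definition Zsqrt2_PCF12 (R : realType) (beta : R[i]) :
    set (R[i] * R[i] * R[i]) :=
  [set t | let: (b1, a1, a2) := t in
    [/\ Zsqrt2 b1, Zsqrt2 a1, Zsqrt2 a2
      & has_value (pcf12 b1 a1 a2) (P1_of_C beta)]].

(* Main.v *)
(* Let [beta = √(2 + √2)] and let [[b, a1, a2, a1, a2, ..]] have value [beta].  The matrix
   [D(b) D(a1) D(a2) D(b)^-1] fixes [beta]; as [beta] is irrational over [Q(√2)], this
   forces [a2 = 2 b] and [a1 (beta ^ 2 - b ^ 2) = 2 b].  Conversely, under these equations
   the n-th convergent is [l (1 + r ^ n) / (1 - r ^ n)] for [l = beta] or [- beta] and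
   [r = (b - l) / (b + l)], so it tends to [beta] exactly when [b > 0].

   Write [b = p + q √2].  The second equation makes [beta ^ 2 - b ^ 2] divide
   [2 (2 + √2)].  If [p] is odd, its norm must be [- 1], so up to conjugation
   [b ^ 2 + u e ^ 2 = 2 + √2] with [u = 1 + √2] and [e] a unit; the elements
   [b + e √-u] of this norm form the orbit of [1 + √-u] under a unit of infinite order,
   and a 2-adic argument of Skolem shows that only four of them, up to signs, have [e] a
   unit.  If [p] is even, descent leads to [w ^ 4 + 1 = 2 y ^ 2] (Fermat) or to Ljunggren's
   [t ^ 2 + 1 = 2 r ^ 4], whose solutions are [r = 1] and [r = 13].  For the latter,
   [(1 - i) (m + n i) ^ 4] has real part [1] where [r = m ^ 2 + n ^ 2]; rotating by
   [3 - 2 i] makes the argument of a Gaussian integer very close to a quarter of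
   [atan (1 / 239)].  Hypergeometric approximations to the latter bound [r], and the
   remaining solutions of the Pell equation [t ^ 2 + 1 = 2 y ^ 2] are enumerated. *)

From Stdlib Require Import ZArith.
From HB Require Import structures.
From mathcomp Require Import all_boot all_order all_algebra complex.
From mathcomp Require Import polyrcf realalg.
From mathcomp Require Import ssrZ zify ring lra.

Set Implicit Arguments.
Unset Strict Implicit.
Unset Printing Implicit Defensive.

Import Order.TTheory GRing.Theory Num.Theory.

Local Open Scope ring_scope.

(** * Hypergeometric approximations to the tangent of atan(1/239)/4 *)

(** The equation [t ^ 2 + 1 = 2 r ^ 4] has the sporadic solution [239 ^ 2 + 1 = 2 * 13 ^ 4], and the
    proof uses it as its tool: after the rotation, the angle to approximate is so small that the
    approximations [b n / a n] converge very fast. Their recurrence has the limiting characteristic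
    equation [x ^ 2 = 3824 x + 64], with roots about [3824.02] and [- 1 / 59.75]. Hence the growth
    bound [3888 ^ n], with [3888 = 3824 + 64], and the error bound [59 ^ (- n)]. A solution of size
    [G] has angle error [O(G ^ -4)], so taking [n] with [G] near [59 ^ n] gives
    [G ^ 3 = O(3888 ^ n)]. Since [3888 ^ 2 < 59 ^ 5], this is [O(G ^ (5/2))], which bounds [G]
    explicitly and leaves a finite list to enumerate. In the odd case, the fourth power of the unit
    is congruent to 1 modulo 4. Each residue of the exponent modulo 4 then contributes exactly one
    solution, because any further multiple of 4 moves the norm of [e] away from [1] and [- 1]. *)

Definition quarter_prod (n k : nat) : nat :=
  (\prod_(i < k) (4 * n + 1 - 4 * i))%N.

Lemma logn2_fact_le k : (logn 2 k`! <= k)%N.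
Proof.
rewrite logn_fact //.
have H m : (\sum_(1 <= i < m.+1) k %/ 2 ^ i <= k - k %/ 2 ^ m)%N.
  elim: m => [|m IH]; first by rewrite big_geq.
  rewrite big_nat_recr //= expnSr divnMA.
  have h : (k %/ 2 ^ m <= k)%N by exact: leq_div.
  by move: IH h; set u := (k %/ 2 ^ m)%N; set S := (\sum_(_ <= _ < _) _)%N; lia.
by apply: leq_trans (H k) _; rewrite leq_subr.
Qed.

(** Write [k! = 2 ^ a * w] with [w] odd. The factor [2 ^ k] absorbs [2 ^ a]. Modulo [w] the number
    [n + 1/4] is an integer [d], and the product becomes [4 ^ k] times a falling factorial of [d],
    which [k!] divides. *)
Lemma fact_dvd_quarter_prod n k : (k <= n)%N ->
  (k`! %| 2 ^ k * quarter_prod n k)%N.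
Proof.
move=> le_kn.
have [w co2 fE] := pfactor_coprime (isT : prime 2) (fact_gt0 k).
have w_odd : odd w by rewrite -coprime2n.
rewrite fE mulnC dvdn_mul ?dvdn_exp2l ?logn2_fact_le //.
have dvd_w : (w %| k`!)%N by rewrite fE dvdn_mulr.
(* As [w ^ 2] is 1 modulo 4, adding [3 w ^ 2] makes [4 n + 1] divisible by 4 without changing it
   modulo [w]; it also makes [d] at least [k], so that no subtraction [d - i] truncates. *)
pose d := ((4 * n + 1 + 3 * w * w) %/ 4)%N.
have dE : (4 * d = 4 * n + 1 + 3 * w * w)%N.
  rewrite /d; have := odd_double_half w; rewrite w_odd -muln2.
  set h := w./2 => E; have -> : (3 * w * w = 4 * (3 * h * h + 3 * h) + 3)%N by nia.
  by rewrite -addnA; lia.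
have le_kd : (k <= d)%N by nia.
have eq_mod : quarter_prod n k = (4 ^ k * d ^_ k)%N %[mod w].
  have -> : (4 ^ k * d ^_ k)%N = (\prod_(i < k) (4 * (d - i)))%N.
    by rewrite big_split /= prod_nat_const card_ord ffact_prod.
  rewrite /quarter_prod.
  apply: (big_ind2 (fun x y => x = y %[mod w])) => //.
    by move=> x1 x2 y1 y2 E1 E2; rewrite -modnMm E1 E2 modnMm.
  move=> i _; have := ltn_ord i => lt_ik.
  have -> : (4 * (d - i) = (3 * w) * w + (4 * n + 1 - 4 * i))%N by lia.
  by rewrite modnMDl.
rewrite /dvdn eq_mod -/(dvdn _ _) dvdn_mull // -bin_ffact dvdn_mull //.
Qed.

(* [2 ^ k * quarter_prod n k / k!] is the integer [8 ^ k * 'C(n + 1/4, k)]. *)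
Definition thue_coef (n s : nat) : nat :=
  if (s <= n)%N
  then ('C(n + s, n) * (2 ^ (n - s) * quarter_prod n (n - s) %/ (n - s)`!))%N
  else 0%N.

Lemma thue_coefE (F : fieldType) (F0 : forall i, (i%:R == 0 :> F) = (i == 0%N)) (n k : nat) :
  (thue_coef (n + k) n)%:R = ((n + k + n)`!)%:R * 2 ^+ k * (quarter_prod (n + k) k)%:R / ((n + k)`!%:R * n`!%:R * k`!%:R) :> F.
Proof.
rewrite /thue_coef leq_addr addKn natrM.
have := fact_dvd_quarter_prod (leq_addl n k) => /dvdnP[m E]. rewrite E mulnK ?fact_gt0 //.
have := bin_fact (leq_addr n (n + k)); rewrite addKn => Fb.
have nz m' : (m'`!%:R != 0 :> F) by rewrite F0 -lt0n fact_gt0.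
have : (2 ^ k * quarter_prod (n + k) k)%:R = (m * k`!)%:R :> F by rewrite E.
rewrite !natrM natrX => E'. rewrite -Fb !natrM.
rewrite -(mulrA _ (2 ^+ k)) E'. field. by rewrite !nz.
Qed.

Lemma quarter_prodS n k : quarter_prod n k.+1 = (quarter_prod n k * (4 * n + 1 - 4 * k))%N.
Proof. by rewrite /quarter_prod big_ord_recr. Qed.

Lemma quarter_prodSS n k : quarter_prod n.+1 k.+1 = ((4 * n + 5) * quarter_prod n k)%N.
Proof.
rewrite /quarter_prod big_ord_recl /=; congr (_ * _)%N; first by lia.
by apply: eq_bigr => i _; rewrite /bump /=; lia.
Qed.

Lemma thue_coef_gt n s : (n < s)%N -> thue_coef n s = 0%N.
Proof. by move=> h; rewrite /thue_coef leqNgt h. Qed.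

(** A contiguity relation of the hypergeometric polynomials, read coefficient by coefficient. In
    each range of [s] all terms are rational multiples of one product of factorials. *)
Lemma thue_coef_rec (F : fieldType) (F0 : forall i, (i%:R == 0 :> F) = (i == 0%N)) m s :
  let n := m.+1%:R in
  n * (n + 1) * (thue_coef m.+2 s)%:R =
  n * (2 * n + 1) *
    (2 * (if s is s'.+1 then (thue_coef m.+1 s')%:R else 0) + 8 * (thue_coef m.+1 s)%:R)
  - 4 * (16 * n * n - 1) * (thue_coef m s)%:R :> F.
Proof.
move=> /=.
have nz i : (i`!%:R != 0 :> F) by rewrite F0 -lt0n fact_gt0.
have nzS i : (i.+1%:R != 0 :> F) by rewrite F0.
case: (ltngtP s m.+1) => [lt_sm|gt_sm|->].
- have {lt_sm} [k ->] : exists k, m = (s + k)%N by exists (m - s)%N; lia.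
  case: s => [|s].
    rewrite !add0n (thue_coefE F0 0 k.+2) (thue_coefE F0 0 k.+1) (thue_coefE F0 0 k).
    rewrite !add0n !addn0 !factS !exprS mulr0 add0r !quarter_prodSS.
    have := nz k; have := nzS k; have := nzS k.+1.
    move: (quarter_prod k k) (k`!) (2%:R ^+ k : F) => Q f P h1 h2 h3.
    by field; rewrite h3 -?natrD ?nat1r !F0.
  have E0 : (s.+1 + k = (s + k).+1)%N by lia.
  have E2 : ((s + k).+1 = s.+1 + k)%N by lia.
  have E3 : ((s + k).+2 = s.+1 + k.+1)%N by lia.
  have E4 : ((s + k).+3 = s.+1 + k.+2)%N by lia.
  have E5 : ((s + k).+2 = s + k.+2)%N by lia.
  rewrite E0.
  have -> : thue_coef (s + k).+3 s.+1 = thue_coef (s.+1 + k.+2) s.+1 by rewrite -E4.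
  have -> : thue_coef (s + k).+2 s.+1 = thue_coef (s.+1 + k.+1) s.+1 by rewrite -E3.
  have -> : thue_coef (s + k).+2 s = thue_coef (s + k.+2) s by rewrite -E5.
  have -> : thue_coef (s + k).+1 s.+1 = thue_coef (s.+1 + k) s.+1 by rewrite -E2.
  rewrite !(thue_coefE F0) -E4 -E3 -E2 -E5.
  have -> : quarter_prod (s + k).+3 k.+2 = ((4 * s + 4 * k + 13) * (4 * s + 4 * k + 9) * quarter_prod (s + k).+1 k)%N.
    by rewrite !quarter_prodSS; lia.
  have -> : quarter_prod (s + k).+2 k.+1 = ((4 * s + 4 * k + 9) * quarter_prod (s + k).+1 k)%N.
    by rewrite !quarter_prodSS; lia.
  have -> : quarter_prod (s + k).+2 k.+2 = ((4 * s + 4 * k + 9) * (4 * s + 5) * quarter_prod (s + k).+1 k)%N.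
    by rewrite quarter_prodS quarter_prodSS; lia.
  have -> : ((s + k).+3 + s.+1 = (s + k + s).+4)%N by lia.
  have -> : ((s + k).+2 + s.+1 = (s + k + s).+3)%N by lia.
  have -> : ((s + k).+2 + s = (s + k + s).+2)%N by lia.
  have -> : ((s + k).+1 + s.+1 = (s + k + s).+2)%N by lia.
  rewrite !factS !exprS.
  have := nz k; have := nz s; have := nz (s + k)%N.
  move: (quarter_prod _ k) (k`!) (s`!) ((s + k)`!) ((s + k + s)`!) (2%:R ^+ k : F) => Q f g h l P h7 h8 h9.
  by field; rewrite h7 h8 h9 -?natrD ?nat1r !F0.
- rewrite [in RHS]thue_coef_gt // (thue_coef_gt (n := m)); last by lia.
  rewrite !mulr0 addr0 subr0; case: s gt_sm => // s; rewrite ltnS leq_eqVlt => /orP[/eqP <-|lt_ms].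
    have := thue_coefE F0 m.+2 0; have := thue_coefE F0 m.+1 0; rewrite !addn0 => -> ->.
    rewrite /quarter_prod !big_ord0.
    have -> : (m.+2 + m.+2 = (m + m).+4)%N by lia.
    have -> : (m.+1 + m.+1 = (m + m).+2)%N by lia.
    rewrite !factS fact0.
    have := nz m; move: (m`!) ((m + m)`!) => f g h.
    by field; rewrite h -?natrD ?nat1r !F0.
  by rewrite !thue_coef_gt ?mulr0 //; lia.
- rewrite [thue_coef m m.+1]thue_coef_gt // mulr0 subr0.
  have := thue_coefE F0 m 1; have := thue_coefE F0 m.+1 1; have := thue_coefE F0 m.+1 0; rewrite !addn1 addn0 => -> -> ->.
  rewrite /quarter_prod !big_ord_recl !big_ord0.
  have -> : (m.+2 + m.+1 = (m + m).+3)%N by lia.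
  have -> : (m.+1 + m.+1 = (m + m).+2)%N by lia.
  have -> : (m.+1 + m = (m + m).+1)%N by lia.
  rewrite !factS fact0 /= !muln0 !subn0 !muln1.
  have := nz m; move: (m`!) ((m + m)`!) => f g h.
  by field; rewrite h -?natrD ?nat1r !F0.
Qed.

(** * Values of the hypergeometric polynomials at a Gaussian integer *)

Section Gauss.
Variables (F : fieldType) (F0 : forall i, (i%:R == 0 :> F) = (i == 0%N)).
Variables (tau : F) (tau2 : tau * tau = -1).

(* Up to scaling and a change of variable, [2F1(- n, - n - 1/4; - 2 n; z)], which occurs
   in the diagonal Pade approximants of [(1 - z) ^ (1/4)]. *)
Definition thue_poly (n : nat) : {poly F} :=
  \poly_(s < n.+1) (thue_coef n s)%:R.

Lemma thue_poly_rec m :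
  let n := m.+1%:R in
  (n * (n + 1)) *: thue_poly m.+2 =
  (n * (2 * n + 1)) *: ((2%:P * 'X + 8%:P) * thue_poly m.+1)
  - (4 * (16 * n * n - 1)) *: thue_poly m.
Proof.
move=> n; apply/polyP => s.
rewrite coefB !coefZ [(_ + _%:P) * _]mulrDl coefD -[_ * 'X * _]mulrA !coefCM coefXM !coef_poly.
have E k i : (if (i < k.+1)%N then (thue_coef k i)%:R else 0) = (thue_coef k i)%:R :> F.
  by case: ltnP => // h; rewrite thue_coef_gt.
by case: s (thue_coef_rec F0 m s) => [|s] /= H; rewrite ?eqxx ?E H.
Qed.

(** At this point [2 x + 8 = - 1912 tau], with [1912 = 8 * 239]. The twist by [tau ^ n] then removes
    [tau] from the recurrence, so that real and imaginary parts satisfy it separately. *)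
Definition thue_val (n : nat) : F := tau ^+ n * (thue_poly n).[- 4 - 956 * tau].

Lemma thue_val_rec m :
  let n := m.+1%:R in
  n * (n + 1) * thue_val m.+2 =
  1912 * n * (2 * n + 1) * thue_val m.+1 + 4 * (16 * n * n - 1) * thue_val m.
Proof.
move=> n; rewrite /thue_val.
have := congr1 (fun p => p.[- 4 - 956 * tau]) (thue_poly_rec m).
rewrite hornerD hornerN !hornerZ hornerM hornerD hornerM !hornerC hornerX -/n.
move: (thue_poly _).[_] (thue_poly _).[_] (thue_poly _).[_] => z y x; clearbody n => H.
have -> : n * (n + 1) * (tau ^+ m.+2 * x) = tau ^+ m * (tau * tau) * (n * (n + 1) * x).
  by rewrite !exprS; ring.
rewrite H exprS tau2; move: (tau ^+ m) => t; ring: tau2.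
Qed.

(** The boolean equality under the existential lets [xchoose] extract the integer sequences
    later. *)
Definition gaussian_int (z : F) := exists u : int * int, z == u.1%:~R + u.2%:~R * tau.

Lemma gaussian_intD x y : gaussian_int x -> gaussian_int y -> gaussian_int (x + y).
Proof.
move=> [[a b] /eqP->] [[c d] /eqP->]; exists (a + c, b + d); apply/eqP.
rewrite /= !rmorphD /=; ring.
Qed.

Lemma gaussian_intM x y : gaussian_int x -> gaussian_int y -> gaussian_int (x * y).
Proof.
move=> [[a b] /eqP->] [[c d] /eqP->]; exists (a * c - b * d, a * d + b * c); apply/eqP.
rewrite /= !rmorphD rmorphN !rmorphM /=; ring: tau2.
Qed.

Lemma gaussian_int_int (x : int) : gaussian_int x%:~R.
Proof. by exists (x, 0) => /=; rewrite mul0r addr0. Qed.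

Lemma gaussian_int_tau : gaussian_int tau.
Proof. by exists (0, 1) => /=; rewrite mul1r add0r. Qed.

Lemma gaussian_intX x n : gaussian_int x -> gaussian_int (x ^+ n).
Proof.
move=> hx; elim: n => [|n IH]; rewrite ?expr0; first exact: (gaussian_int_int 1).
by rewrite exprS; apply: gaussian_intM.
Qed.

Lemma gaussian_int_thue_val n : gaussian_int (thue_val n).
Proof.
apply: gaussian_intM; first exact/gaussian_intX/gaussian_int_tau.
rewrite /thue_poly horner_poly; apply: (big_ind gaussian_int).
- exact: (gaussian_int_int 0).
- exact: gaussian_intD.
move=> i _; apply: gaussian_intM; first exact: (gaussian_int_int (thue_coef n i)).
apply: gaussian_intX; exists (- 4, - 956) => /=; apply/eqP; ring.
Qed.

Lemma thue_val0 : thue_val 0 = 1.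
Proof.
rewrite /thue_val /thue_poly horner_poly big_ord_recl big_ord0.
have -> : thue_coef 0 0 = 1%N by rewrite /thue_coef /quarter_prod big_ord0.
by rewrite !expr0; ring.
Qed.

Lemma thue_val1 : thue_val 1 = (1912 : int)%:~R + (2 : int)%:~R * tau.
Proof.
rewrite /thue_val /thue_poly horner_poly !big_ord_recl big_ord0.
have -> : thue_coef 1 0 = 10%N by rewrite /thue_coef /quarter_prod big_ord_recl big_ord0.
have -> : thue_coef 1 1 = 2%N by rewrite /thue_coef /quarter_prod big_ord0.
rewrite !expr1 expr0; ring: tau2.
Qed.
End Gauss.

Lemma natc_eq0 i : (i%:R == 0 :> rat[i]) = (i == 0%N).
Proof.
have -> : i%:R = (i%:R)%:C%C :> rat[i] by rewrite rmorph_nat.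
by rewrite fmorph_eq0 pnatr_eq0.
Qed.

Lemma i_mul_i : ('i%C : rat[i]) * 'i%C = -1.
Proof. by apply/eqP; rewrite eq_complex /=; apply/andP; split; apply/eqP; ring. Qed.

Lemma gauss_eq0 (x y : int) : x%:~R + y%:~R * 'i%C = 0 :> rat[i] -> x = 0 /\ y = 0.
Proof.
have C (z : int) : z%:~R = (z%:~R)%:C%C :> rat[i] by rewrite rmorph_int.
rewrite !C; move: (x%:~R : rat) (y%:~R : rat) (@intr_eq0 rat x) (@intr_eq0 rat y) => u v hu hv.
move=> E; have /= Er := congr1 (@complex.Re rat) E; have /= Ei := congr1 (@complex.Im rat) E.
have u0 : u = 0 by rewrite -Er; ring.
have v0 : v = 0 by rewrite -Ei; ring.
by move: hu hv; rewrite u0 v0 eqxx => /esym/eqP -> /esym/eqP ->.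
Qed.

(** Real and imaginary parts of [thue_val] at the imaginary unit; [b n / a n] will approximate the
    tangent [s / c]. *)
Lemma thue_sequences : exists a b : nat -> int,
  [/\ a 0%N = 1, b 0%N = 0, a 1%N = 1912, b 1%N = 2 &
    forall m (n := m.+1%:Z),
      n * (n + 1) * a m.+2 = 1912 * n * (2 * n + 1) * a m.+1 + 4 * (16 * n * n - 1) * a m /\
      n * (n + 1) * b m.+2 = 1912 * n * (2 * n + 1) * b m.+1 + 4 * (16 * n * n - 1) * b m].
Proof.
pose P n (u : int * int) := thue_val ('i%C : rat[i]) n == u.1%:~R + u.2%:~R * 'i%C.
have G n : exists u, P n u := gaussian_int_thue_val i_mul_i n.
pose ab n := xchoose (G n); exists (fun n => (ab n).1), (fun n => (ab n).2).
have abE n : thue_val 'i%C n = (ab n).1%:~R + (ab n).2%:~R * 'i%C :> rat[i].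
  by have /eqP := xchooseP (G n).
have inj (x y x' y' : int) : x%:~R + y%:~R * 'i%C = x'%:~R + y'%:~R * 'i%C :> rat[i] -> x = x' /\ y = y'.
  move=> E; have [] := @gauss_eq0 (x - x') (y - y').
    by rewrite !rmorphB /= mulrBl addrACA E -opprD subrr.
  by move=> /eqP; rewrite subr_eq0 => /eqP -> /eqP; rewrite subr_eq0 => /eqP ->.
have [a0 b0] : (ab 0%N).1 = 1 /\ (ab 0%N).2 = 0.
  by apply: inj; rewrite -abE thue_val0 mul0r addr0.
have [a1 b1] : (ab 1%N).1 = 1912 /\ (ab 1%N).2 = 2.
  by apply: inj; rewrite -abE (thue_val1 i_mul_i).
split; [exact: a0|exact: b0|exact: a1|exact: b1|move=> m n].
apply: inj.
have := thue_val_rec natc_eq0 i_mul_i m; rewrite !abE.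
have -> : m.+1%:R = n%:~R :> rat[i] by [].
move: (ab m) (ab m.+1) (ab m.+2) n => [x y] [x' y'] [x'' y''] n H.
rewrite [LHS](_ : _ = n%:~R * (n%:~R + 1) * ((x'', y'').1%:~R + (x'', y'').2%:~R * 'i%C)); last by ring.
rewrite H; ring.
Qed.

(** * Antiderivatives of polynomials over a real closed field *)

Section Primitive.
Variable R : rcfType.
Implicit Types p q : {poly R}.

(** At [i = 0] the division by zero gives 0, so this is the antiderivative that vanishes at 0. *)
Definition primitive p : {poly R} := \poly_(i < (size p).+1) (p`_i.-1 / i%:R).

Lemma coef_primitive p i : (primitive p)`_i = p`_i.-1 / i%:R.
Proof.
rewrite coef_poly; case: ltnP => // h; rewrite nth_default ?mul0r //.
by case: i h.
Qed.

Lemma deriv_primitive p : (primitive p)^`() = p.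
Proof.
by apply/polyP => i; rewrite coef_deriv coef_primitive /= -[LHS]mulr_natr mulfVK ?pnatr_eq0 //.
Qed.

Lemma primitive_deriv p : primitive p^`() = p - (p`_0)%:P.
Proof.
apply/polyP => i; rewrite coef_primitive coefB coefC coef_deriv.
case: i => [|i] /=; first by rewrite invr0 mulr0 subrr.
by rewrite subr0 -[_ *+ _]mulr_natr mulfK // pnatr_eq0.
Qed.

Lemma primitiveD p q : primitive (p + q) = primitive p + primitive q.
Proof. by apply/polyP => i; rewrite !(coef_primitive, coefD) mulrDl. Qed.

Lemma primitiveZ a p : primitive (a *: p) = a *: primitive p.
Proof. by apply/polyP => i; rewrite !(coef_primitive, coefZ) mulrA. Qed.

Lemma primitive_mvt p x : 0 < x ->
  exists2 y, 0 < y < x & (primitive p).[x] = p.[y] * x.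
Proof.
move=> x0; have [y] := poly_mvt (primitive p) x0.
rewrite in_itv /= deriv_primitive subr0 => hy E; exists y => //; rewrite -E.
by rewrite horner_coef0 coef_primitive invr0 mulr0 subr0.
Qed.
End Primitive.

(* [K] is [M cos (4 x) - 239] as a polynomial in [v = sin x]; the remainder
   is the integral of [K ^ n] over [[0, s]], [s] being its root. *)
Definition thue_kernel (R : rcfType) (M : R) : {poly R} :=
  M *: (8 *: 'X^4 - 8 *: 'X^2 + 1) - 239%:P.

Definition remainder (R : rcfType) (M s : R) (n : nat) : R :=
  (primitive (thue_kernel M ^+ n)).[s].

Section Remainder.
Variables (R : rcfType) (M s c : R).
Hypotheses (M0 : 0 < M) (M2 : M * M = 239 * 239 + 1) (s0 : 0 < s) (c0 : 0 < c).
Hypotheses (sc1 : s * s + c * c = 1).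
Hypothesis Mcos : M * (8 * s ^+ 4 - 8 * s ^+ 2 + 1) = 239.
Hypothesis Msin : M * (4 * s * c * (1 - 2 * s ^+ 2)) = 1.
Hypothesis s_lt : 2 * s ^+ 2 < 1.

Let K := thue_kernel M.

Let E := remainder M s.

Let KE : K = M%:P * (8%:P * ('X * 'X * ('X * 'X)) - 8%:P * ('X * 'X) + 1) - 239%:P.
Proof. by rewrite /K /thue_kernel -!mul_polyC !exprS expr0 !mulr1 !mulrA. Qed.

Let Ks : K.[s] = 0.
Proof. by rewrite KE !(hornerD, hornerN, hornerM, hornerC, hornerX) -Mcos; ring. Qed.

(* [G] is the boundary term of an integration by parts, vanishing at [0] and [s]. *)
Lemma remainder_rec m (n := m.+1%:R) :
  (16 * ((n + 1) * (n + 1)) - 1) * E m.+2 =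
  16 * n * (n + 1) * E m - 16 * 239 * (2 * n + 1) * (n + 1) * E m.+1.
Proof.
(* [Q] is [sin (4 x) cos x] in [v = sin x]. The derivative of [G] closes on powers of [K] because
   [M2] turns [(M sin (4 x)) ^ 2] into [1 - 478 K - K ^ 2]. *)
pose Q : {poly R} := 4%:P * ('X * (1 - 'X * 'X) * (1 - 2%:P * ('X * 'X))).
pose N : {poly R} := m.+1%:R.
pose G := 4 * (N + 1) * M%:P * (Q * K ^+ m.+1) - 'X * K ^+ m.+2.
have dG : (16 * ((N + 1) * (N + 1)) - 1) * K ^+ m.+2 =
  16 * N * (N + 1) * K ^+ m - 16 * 239 * (2 * N + 1) * (N + 1) * K ^+ m.+1 + G^`().
  have dQ : Q^`() = 4%:P * (1 - 9%:P * ('X * 'X) + 10%:P * ('X * 'X * ('X * 'X))).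
    rewrite /Q !(derivM, derivC, derivX, derivB, derivD); ring.
  have dK : K^`() = M%:P * (32%:P * ('X * 'X * 'X) - 16%:P * 'X).
    rewrite KE !(derivM, derivC, derivX, derivB, derivD); ring.
  have M2P : M%:P * M%:P = 239%:P * 239%:P + 1 :> {poly R} by rewrite -!polyCM M2 polyCD.
  have QE : Q = 4%:P * ('X * (1 - 'X * 'X) * (1 - 2%:P * ('X * 'X))) by [].
  have dN : (4 * (N + 1) * M%:P)^`() = 0.
    have -> : 4 * (N + 1) * M%:P = (4 * (m.+1%:R + 1) * M)%:P.
      by rewrite !polyCM [(_ + 1)%:P]polyCD (polyC_natr _ 4) (polyC_natr _ m.+1).
    by rewrite derivC.
  rewrite /G; clearbody Q; move: KE dK => KE' dK; clear G KE Ks E; clearbody K.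
  rewrite derivB derivM dN mul0r add0r derivM [('X * _)^`()]derivM derivX !deriv_exp /= dQ dK.
  rewrite -[_ *+ m.+1]mulr_natr -[_ *+ m.+2]mulr_natr !exprS.
  have -> : m.+2%:R = N + 1 by rewrite /N -[in LHS]addn1 natrD.
  rewrite -/N; clearbody N.
  have e i : i%:R%:P = i%:R :> {poly R} by rewrite polyC_natr.
  move: (K ^+ m) => T.
  rewrite (e 4) (e 9) (e 10) (e 32) (e 16).
  rewrite (e 8) (e 239) in KE' M2P; rewrite (e 4) (e 2) in QE.
  rewrite QE KE'.
  move: (M%:P) M2P ('X : {poly R}) => C hC X.
  ring: hC.
have e i : i%:R%:P = i%:R :> {poly R} by rewrite polyC_natr.
have cN : N = n%:P by rewrite polyC_natr.
have c1 : 16 * ((N + 1) * (N + 1)) - 1 = (16 * ((n + 1) * (n + 1)) - 1)%:P.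
  by rewrite cN -(e 16) -(polyC1 R) -!(polyCM, polyCD, polyCB).
have c2 : 16 * N * (N + 1) = (16 * n * (n + 1))%:P.
  by rewrite cN -(e 16) -(polyC1 R) -!(polyCM, polyCD, polyCB).
have c3 : 16 * 239 * (2 * N + 1) * (N + 1) = (16 * 239 * (2 * n + 1) * (n + 1))%:P.
  by rewrite cN -(e 16) -(e 239) -(e 2) -(polyC1 R) -!(polyCM, polyCD, polyCB).
have G0 : (primitive G^`()).[s] = 0.
  rewrite primitive_deriv -horner_coef0 hornerD hornerN hornerC /G.
  rewrite !(hornerD, hornerN) ![(_ * (Q * _)).[_]]hornerM ![(Q * _).[_]]hornerM.
  rewrite ![('X * _).[_]]hornerM !hornerX !horner_exp Ks !exprS !mul0r !mulr0.
  rewrite (_ : Q.[0] = 0); first by ring.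
  by rewrite /Q hornerM hornerM hornerM hornerX !(mul0r, mulr0).
have := congr1 (fun p => (primitive p).[s]) dG.
rewrite c1 c2 c3 -mulNr -polyCN !mul_polyC !primitiveD !primitiveZ !hornerD !hornerZ G0 /E /remainder -/K => ->.
ring.
Qed.

(** On [[0, s]] the kernel factors as [8 M (s ^ 2 - y ^ 2) (1 - s ^ 2 - y ^ 2)], hence is
    nonnegative, and it is at most its value [M - 239] at 0. *)
Lemma remainder_bound n : 0 <= E n <= s * (M - 239) ^+ n.
Proof.
have [y /andP[y0 ys] EE] := primitive_mvt (K ^+ n) s0.
rewrite /E /remainder -/K EE mulrC horner_exp.
have Ky : K.[y] = 8 * M * ((s ^+ 2 - y ^+ 2) * (1 - s ^+ 2 - y ^+ 2)).
  by rewrite KE !(hornerD, hornerN, hornerM, hornerC, hornerX) -Mcos; ring.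
have y2 : 0 < y ^+ 2 by rewrite exprn_gt0.
have ys2 : y ^+ 2 < s ^+ 2 by rewrite ltr_pXn2r // nnegrE ltW.
have K0 : 0 <= K.[y].
  rewrite Ky; apply: mulr_ge0; [by rewrite mulr_ge0 ?ler0n ?ltW|].
  apply: mulr_ge0; first by rewrite subr_ge0 ltW.
 by have := s_lt; lra.
have K1 : K.[y] <= M - 239.
  rewrite KE !(hornerD, hornerN, hornerM, hornerC, hornerX) lerD2r -[leRHS]mulr1.
  rewrite ler_pM2l //.
  have : 0 <= (y * y) * (1 - y * y) by apply: mulr_ge0; have := s_lt; rewrite -!expr2; lra.
  by move: (y * y) => z; lra.
by rewrite mulr_ge0 ?exprn_ge0 ?(ltW s0) //= ler_pM2l // lerXn2r // nnegrE ?(le_trans K0).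
Qed.

(** The normalisation that, together with the sign [(- 1) ^ n], converts the recurrence of the
    integrals into that of [a] and [b]. *)
Let kappa (n : nat) : R := \prod_(i < n) ((16 * (i.+1%:R * i.+1%:R) - 1) / (2 * (i.+1%:R * i.+1%:R))).

Lemma kappaS n : 2 * (n.+1%:R * n.+1%:R) * kappa n.+1 = (16 * (n.+1%:R * n.+1%:R) - 1) * kappa n.
Proof.
rewrite /kappa big_ord_recr /=; field.
by rewrite ?andbT ?nat1r ?pnatr_eq0.
Qed.

Lemma kappa_bound n : 0 < kappa n <= 8 ^+ n.
Proof.
elim: n => [|n /andP[IH1 IH2]]; first by rewrite /kappa big_ord0 expr0 ltr01 lexx.
rewrite /kappa big_ord_recr /= -/(kappa n) exprSr.
have h : 1 <= n.+1%:R :> R by rewrite ler1n.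
have h2 : 1 <= n.+1%:R * n.+1%:R :> R by rewrite -[leLHS]mulr1 ler_pM.
move: (n.+1%:R * n.+1%:R) h2 => u u1.
have u0 : 0 < 2 * u by lra.
have f0 : 0 < (16 * u - 1) / (2 * u) by apply: divr_gt0; lra.
rewrite mulr_gt0 //= ler_pM ?(ltW f0) ?(ltW IH1) //.
by rewrite ler_pdivrMr //; lra.
Qed.

Lemma remainder0 : E 0 = s.
Proof.
rewrite /E /remainder expr0; have [y _ ->] := primitive_mvt 1 s0.
by rewrite hornerC mul1r.
Qed.

Lemma remainder1 : 15 * E 1 = - (2 * (8 * 239 * s - 2 * c)).
Proof.
pose A : {poly R} := M%:P * (24%:P * ('X * 'X * 'X * 'X * 'X) - 40%:P * ('X * 'X * 'X) + 15%:P * 'X)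
   - 15%:P * (239%:P * 'X).
have dA : A^`() = 15 *: K.
  rewrite -mul_polyC KE /A !(derivM, derivC, derivX, derivB, derivD); ring.
have := primitive_deriv A; rewrite dA primitiveZ => /(congr1 (horner^~ s)).
rewrite hornerZ /E /remainder expr1 -/K => ->.
rewrite -horner_coef0 /A !(hornerD, hornerN, hornerM, hornerC, hornerX).
have -> : 2 * c = 8 * M * s * (1 - s * s) * (1 - 2 * s ^+ 2).
  have -> : 1 - s * s = c * c by rewrite -sc1; ring.
  transitivity (2 * c * (M * (4 * s * c * (1 - 2 * s ^+ 2)))); last by ring.
  by rewrite Msin mulr1.
rewrite -Mcos; ring.
Qed.

Lemma linear_form_eq (a b : nat -> int) :
  a 0%N = 1 -> b 0%N = 0 -> a 1%N = 1912 -> b 1%N = 2 ->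
  (forall m (n := m.+1%:Z),
     n * (n + 1) * a m.+2 = 1912 * n * (2 * n + 1) * a m.+1 + 4 * (16 * n * n - 1) * a m /\
     n * (n + 1) * b m.+2 = 1912 * n * (2 * n + 1) * b m.+1 + 4 * (16 * n * n - 1) * b m) ->
  forall n, (a n)%:~R * s - (b n)%:~R * c = (- 1) ^+ n * kappa n * E n.
Proof.
move=> a0 b0 a1 b1 rec.
pose L n := (a n)%:~R * s - (b n)%:~R * c.
have recL m (n := m.+1%:R : R) :
  n * (n + 1) * L m.+2 = 1912 * n * (2 * n + 1) * L m.+1 + 4 * (16 * n * n - 1) * L m.
  have [/(congr1 (fun x => x%:~R : R)) ra /(congr1 (fun x => x%:~R : R)) rb] := rec m.
  rewrite /L; have -> : n * (n + 1) * ((a m.+2)%:~R * s - (b m.+2)%:~R * c) =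
    (m.+1%:Z * (m.+1%:Z + 1) * a m.+2)%:~R * s - (m.+1%:Z * (m.+1%:Z + 1) * b m.+2)%:~R * c.
    by rewrite /n; ring.
  by rewrite ra rb /n; ring.
suff H n : L n = (- 1) ^+ n * kappa n * E n /\ L n.+1 = (- 1) ^+ n.+1 * kappa n.+1 * E n.+1.
  by move=> n; have [] := H n.
elim: n => [|m [IH0 IH1]].
  rewrite remainder0 /L a0 b0 a1 b1 /kappa big_ord_recl !big_ord0 expr0 expr1.
  have -> : E 1 = - (2 / 15) * (8 * 239 * s - 2 * c) by have := remainder1; lra.
  by split; [ring|rewrite /=; field].
split=> //.
have nS : m.+2%:R = m.+1%:R + 1 :> R by rewrite -[in LHS]addn1 natrD.
have n0 : m.+1%:R != 0 :> R by rewrite pnatr_eq0.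
have n1 : m.+1%:R + 1 != 0 :> R by rewrite -nS pnatr_eq0.
have Rm := recL m; have Em := remainder_rec m.
have k1 := kappaS m; have k2 := kappaS m.+1; rewrite nS in k2.
rewrite IH0 IH1 in Rm; move: Rm Em k1 k2; rewrite -!/(E _) -/E.
move: (m.+1%:R) n0 n1 => n n0 n1 Rm Em k1 k2.
have nz : 2 * (n * n) * ((n + 1) * (n + 1)) != 0 by rewrite !mulf_neq0 ?pnatr_eq0.
apply: (mulfI nz); rewrite !exprS; move: Rm; rewrite !exprS.
move: ((-1) ^+ m) (L m.+2) (E m) (E m.+1) (E m.+2) (kappa m) (kappa m.+1) (kappa m.+2) Em k1 k2.
move=> sg L2 E0 E1 E2 q0 q1 q2 Em k1 k2 Rm.
transitivity (2 * n * (n + 1) * (n * (n + 1) * L2)); first by ring.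
transitivity (sg * (n * n) * E2 * (2 * ((n + 1) * (n + 1)) * q2)); last by ring.
rewrite k2; transitivity (sg * (n * n) * q1 * ((16 * ((n + 1) * (n + 1)) - 1) * E2)); last by ring.
rewrite Em Rm.
transitivity (sg * (8 * n * (n + 1) * E0 * (2 * (n * n) * q1)
   - 16 * 239 * (2 * n + 1) * (n + 1) * (n * n) * q1 * E1)); last by ring.
rewrite k1; ring.
Qed.

(** [M - 239 = 1 / (M + 239)] is below [1 / 478], and [kappa n] is at most [8 ^ n], so each step
    gains a factor [8 / 478 < 1 / 59]. *)
Lemma linear_form_bound (a b : nat -> int) :
  a 0%N = 1 -> b 0%N = 0 -> a 1%N = 1912 -> b 1%N = 2 ->
  (forall m (n := m.+1%:Z),
     n * (n + 1) * a m.+2 = 1912 * n * (2 * n + 1) * a m.+1 + 4 * (16 * n * n - 1) * a m /\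
     n * (n + 1) * b m.+2 = 1912 * n * (2 * n + 1) * b m.+1 + 4 * (16 * n * n - 1) * b m) ->
  forall n, `|(a n)%:~R * s - (b n)%:~R * c| * 59 ^+ n <= s.
Proof.
move=> a0 b0 a1 b1 rec n; rewrite (linear_form_eq a0 b0 a1 b1 rec).
have /andP[k0 k8] := kappa_bound n; have /andP[E0 En] := remainder_bound n.
rewrite -mulrA normrM normrX normrN1 expr1n mul1r ger0_norm ?mulr_ge0 ?(ltW k0) //.
have Mdiff : (M - 239) * (M + 239) = 1.
  by transitivity (M * M - 239 * 239); [ring|rewrite M2; ring].
have Mgt : 0 < M - 239.
  by rewrite -(pmulr_lgt0 _ (x := M + 239)) ?Mdiff // ; have := M0; lra.
have h : 0 <= 8 * (M - 239) * 59 <= 1.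
  have : (M - 239) * 478 <= (M - 239) * (M + 239) by rewrite ler_pM2l //; lra.
  by rewrite Mdiff => h; apply/andP; split; lra.
have /andP[h0 h1] := h; have := ler_pM (ltW k0) E0 k8 En.
move=> /ler_wpM2r hE; apply: le_trans (hE (59 ^+ n) _) _; first by rewrite exprn_ge0.
have -> : 8 ^+ n * (s * (M - 239) ^+ n) * 59 ^+ n = s * (8 * (M - 239) * 59) ^+ n.
  by rewrite !exprMn; ring.
by rewrite -[leRHS]mulr1 ler_pM2l // exprn_ile1.
Qed.
End Remainder.

(** * The bound on the solutions of the rotated quartic equations *)

Definition thue_recurrence (a : nat -> int) : Prop :=
  forall m (n := m.+1%:Z),
    n * (n + 1) * a m.+2 = 1912 * n * (2 * n + 1) * a m.+1 + 4 * (16 * n * n - 1) * a m.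

Lemma thue_re_bound a : a 0%N = 1 -> a 1%N = 1912 -> thue_recurrence a ->
  forall n, 0 < a n <= 3888 ^+ n.
Proof.
move=> a0 a1 rec.
suff H n : [/\ 0 < a n, a n <= a n.+1, a n <= 3888 ^+ n & a n.+1 <= 3888 ^+ n.+1].
  by move=> n; have [-> _ -> _] := H n.
elim: n => [|m [p0 le01 b0 b1]]; first by rewrite a0 a1 expr0 expr1; split; lia.
have nn : 0 < m.+1%:Z * (m.+1%:Z + 1) by lia.
have h1 : a m.+1 <= a m.+2.
  by rewrite -(ler_pM2l nn) rec; nia.
split=> //; first by apply: lt_le_trans p0 _.
have h2 : a m.+2 <= 3888 * a m.+1.
  by rewrite -(ler_pM2l nn) rec; nia.
by apply: le_trans h2 _; rewrite [X in _ <= X]exprS ler_pM2l.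
Qed.

(** The recurrence multiplies this Casoratian by a nonzero factor at each step. It guarantees that
    two consecutive approximations cannot both equal a given fraction. *)
Lemma thue_det_neq0 a b : a 0%N = 1 -> b 0%N = 0 -> a 1%N = 1912 -> b 1%N = 2 ->
  thue_recurrence a -> thue_recurrence b ->
  forall n, a n * b n.+1 - a n.+1 * b n != 0.
Proof.
move=> a0 b0 a1 b1 ra rb; elim=> [|m IH]; first by rewrite a0 b0 a1 b1.
have := ra m; have := rb m; set n := m.+1%:Z => eb ea.
have E : n * (n + 1) * (a m.+1 * b m.+2 - a m.+2 * b m.+1) =
   - (4 * (16 * n * n - 1)) * (a m * b m.+1 - a m.+1 * b m).
  transitivity (a m.+1 * (n * (n + 1) * b m.+2) - (n * (n + 1) * a m.+2) * b m.+1); first by ring.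
  by rewrite ea eb; ring.
apply/negP => /eqP E0; move: E; rewrite E0 mulr0 => /esym/eqP; apply/negP.
by rewrite mulf_neq0 // /n; lia.
Qed.

(* [s] and [c] are the sine and cosine of a quarter of [atan (1 / 239)]. *)
Lemma small_angle (R : rcfType) : exists M s c : R,
  [/\ 0 < M, M * M = 239 * 239 + 1, 0 < s, 0 < c & s * s + c * c = 1] /\
  [/\ M * (8 * s ^+ 4 - 8 * s ^+ 2 + 1) = 239,
     M * (4 * s * c * (1 - 2 * s ^+ 2)) = 1 & 2 * s ^+ 2 < 1].
Proof.
pose M : R := Num.sqrt (239 * 239 + 1).
have M0 : 0 < M by rewrite sqrtr_gt0; lra.
have M2 : M * M = 239 * 239 + 1 by rewrite -expr2 sqr_sqrtr //; lra.
have Mdiff : (M - 239) * (M + 239) = 1.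
  by transitivity (M * M - 239 * 239); [ring|rewrite M2; ring].
have Mgt : 239 < M.
  by rewrite -subr_gt0 -(pmulr_lgt0 _ (x := M + 239)) ?Mdiff //; lra.
clearbody M.
(* [C4] and [C2] are the cosines of four times and twice the angle; the half-angle formulas lead
   from one to the next. *)
pose C4 := 239 / M.
have C4b : 0 < C4 < 1 by rewrite divr_gt0 //= ltr_pdivrMr ?mul1r.
have C4M : M * C4 = 239 by rewrite /C4 mulrCA mulfV ?mulr1 ?lt0r_neq0.
have S4 : M * M * (1 - C4 * C4) = 1.
  by transitivity (M * M - (M * C4) * (M * C4)); [ring|rewrite C4M M2; ring].
clearbody C4; move: C4b => /andP[C4p C4l].
pose C2 := Num.sqrt ((1 + C4) / 2).
have C2p : 0 < C2 by rewrite sqrtr_gt0; lra.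
have C22 : C2 * C2 = (1 + C4) / 2 by rewrite -expr2 sqr_sqrtr //; lra.
have C2l : C2 < 1 by nra.
clearbody C2.
pose c := Num.sqrt ((1 + C2) / 2); pose s := Num.sqrt ((1 - C2) / 2).
have cp : 0 < c by rewrite sqrtr_gt0; lra.
have sp : 0 < s by rewrite sqrtr_gt0; lra.
have c2 : c * c = (1 + C2) / 2 by rewrite -expr2 sqr_sqrtr //; lra.
have s2 : s * s = (1 - C2) / 2 by rewrite -expr2 sqr_sqrtr //; lra.
clearbody c s.
exists M, s, c; split; split=> //.
- by rewrite s2 c2; field.
- transitivity (M * (8 * (s * s) * (s * s) - 8 * (s * s) + 1)); first by ring.
  by rewrite s2 -C4M; congr (_ * _); transitivity (2 * (C2 * C2) - 1); [field|rewrite C22; field].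
- have h : 0 < M * (4 * s * c * (1 - 2 * s ^+ 2)).
    by rewrite expr2 s2; apply: mulr_gt0 => //; rewrite !mulr_gt0 ?ltr0n //; lra.
  have h2 : M * (4 * s * c * (1 - 2 * s ^+ 2)) * (M * (4 * s * c * (1 - 2 * s ^+ 2))) = 1.
    transitivity (M * M * (16 * (s * s) * (c * c) * ((1 - 2 * (s * s)) * (1 - 2 * (s * s))))); first by ring.
    have -> : 16 * (s * s) * (c * c) * ((1 - 2 * (s * s)) * (1 - 2 * (s * s))) =
      4 * (1 - C2 * C2) * (C2 * C2) by rewrite s2 c2; field.
    by rewrite C22 -[RHS]S4; field.
  apply/eqP; rewrite -(eqrXn2 (n := 2)) ?(ltW h) // expr1n expr2 h2 //.
- by rewrite expr2 s2; lra.
Qed.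

Lemma small_angle_bounds (R : rcfType) (M s c : R) :
  0 < M -> M * M = 239 * 239 + 1 -> 0 < s -> 0 < c -> s * s + c * c = 1 ->
  M * (8 * s ^+ 4 - 8 * s ^+ 2 + 1) = 239 -> 2 * s ^+ 2 < 1 ->
  [/\ s <= 1 / 600, 99 / 100 <= c, c <= 1 & M < 240].
Proof.
move=> M0 M2 s0 c0 sc1 Mcos sl.
have Mdiff : (M - 239) * (M + 239) = 1.
  by transitivity (M * M - 239 * 239); [ring|rewrite M2; ring].
have Mgt : 239 < M.
  by rewrite -subr_gt0 -(pmulr_lgt0 _ (x := M + 239)) ?Mdiff //; lra.
have Mlt : (M - 239) * 478 <= 1.
  have : (M - 239) * 478 <= (M - 239) * (M + 239) by rewrite ler_pM2l; lra.
  by rewrite Mdiff.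
have E : M * (8 * (s * s) * (c * c)) = M - 239.
  rewrite -[in RHS]Mcos; have -> : c * c = 1 - s * s by rewrite -sc1; ring.
  by ring.
have cc : 1 / 2 < c * c by rewrite expr2 in sl; lra.
have h : 239 * (4 * (s * s)) <= M - 239.
  rewrite -E; apply: ler_pM; [lra| |lra|]; first by rewrite !mulr_ge0 ?ltW.
  have : 0 <= s * s by rewrite mulr_ge0 ?ltW.
  by move: (s * s) (c * c) cc => u v; nra.
have s2 : s * s * (956 * 478) <= 1 by lra.
have s3 : s <= 1 / 600 by rewrite leNgt; apply/negP => h6; nra.
have c1 : c <= 1 by nra.
have c2 : 99 / 100 <= c by rewrite leNgt; apply/negP => h6; nra.
by split=> //; lra.
Qed.

(** Positivity of the real part puts [l ^ 2 / g ^ 2] below [3 - 2 √2 < 9 / 50] or above [3 + 2 √2],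
    and [|l| <= 11 / 10 * g] excludes the latter. So [g ^ 2 - l ^ 2] is at least [41 / 50 * g ^ 2],
    and the imaginary part gives [120 * 50 / 41 < 147]. *)
Lemma thue_close_form (R : rcfType) (M g l k : R) :
  0 < M -> M < 240 -> -4 <= k <= 4 ->
  0 < g -> `|l| <= 11 / 10 * g -> 0 < 2 * (g ^+ 4 - 6 * g ^+ 2 * l ^+ 2 + l ^+ 4) ->
  8 * g * l * (g ^+ 2 - l ^+ 2) = - M * k -> `|l| * g ^+ 3 <= 147.
Proof.
move=> M0 M1 /andP[k1 k2] g0 lg re im.
have g2 : 0 < g ^+ 2 by rewrite exprn_gt0.
have x0 : 0 <= l ^+ 2 by rewrite sqr_ge0.
have xy : l ^+ 2 <= 121 / 100 * g ^+ 2.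
  rewrite -real_normK ?num_real //; have -> : 121 / 100 * g ^+ 2 = (11 / 10 * g) ^+ 2 by field.
  by rewrite lerXn2r // nnegrE ?normr_ge0 //; lra.
have x18 : l ^+ 2 <= 9 / 50 * g ^+ 2.
  rewrite leNgt; apply/negP => h.
  have : 0 <= (l ^+ 2 - 9 / 50 * g ^+ 2) * (121 / 100 * g ^+ 2 - l ^+ 2).
    by apply: mulr_ge0; lra.
  have : 0 <= g ^+ 2 * (l ^+ 2 - 9 / 50 * g ^+ 2) by apply: mulr_ge0; lra.
  have := exprn_gt0 2 g2; move: re.
  have -> : g ^+ 4 = (g ^+ 2) ^+ 2 by rewrite -exprM.
  have -> : l ^+ 4 = (l ^+ 2) ^+ 2 by rewrite -exprM.
  by move: (g ^+ 2) (l ^+ 2) => x y; lra.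
have nk : `|k| <= 4 by rewrite ler_norml k1.
have := congr1 (fun x => `|x|) im; rewrite !normrM normrN (gtr0_norm g0) (ger0_norm (_ : 0 <= 8)) //.
rewrite (ger0_norm (_ : 0 <= g ^+ 2 - l ^+ 2)); last by lra.
rewrite (gtr0_norm M0) => E.
have Mk : M * `|k| <= 240 * 4 by apply: ler_pM; rewrite ?(ltW M0) ?(ltW M1).
have hgl : 0 <= g * `|l| by rewrite mulr_ge0 ?(ltW g0).
have h82 : g * `|l| * (41 / 50 * g ^+ 2) <= g * `|l| * (g ^+ 2 - l ^+ 2).
  by apply: ler_wpM2l => //; lra.
have {}E : 8 * (g * `|l| * (g ^+ 2 - l ^+ 2)) = M * `|k| by rewrite -E; ring.
have -> : `|l| * g ^+ 3 = 50 / 41 * (g * `|l| * (41 / 50 * g ^+ 2)) by field.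
move: E h82 Mk; move: (_ * (_ - _)) (_ * (_ / _ * _)) (M * _) => x y z; lra.
Qed.

Lemma rotation_bounds (R : rcfType) (G H s c : R) :
  1 <= G -> `|H| <= G -> 0 < s -> 0 < c -> s <= 1 / 600 -> 99 / 100 <= c -> c <= 1 ->
  49 / 50 * G <= G * c + H * s /\ `|H * c - G * s| <= 51 / 50 * G.
Proof.
move=> G1 HG s0 c0 s600 c99 c1.
have Gc : 99 / 100 * G <= G * c by rewrite [leRHS]mulrC ler_wpM2r //; lra.
have Gc1 : G * c <= G by rewrite ger_pMr //; lra.
have Gs : G * s <= 1 / 600 * G by rewrite [leRHS]mulrC ler_wpM2l //; lra.
have Hs : `|H * s| <= G * s by rewrite normrM (gtr0_norm s0) ler_wpM2r // ltW.
have Hc : `|H * c| <= G by rewrite normrM (gtr0_norm c0) (le_trans _ Gc1) // ler_wpM2r // ltW.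
have [Hs1 Hs2] : - (G * s) <= H * s /\ H * s <= G * s by apply/andP; rewrite -ler_norml.
have [Hc1 Hc2] : - G <= H * c /\ H * c <= G by apply/andP; rewrite -ler_norml.
have Gs0 : 0 <= G * s by rewrite mulr_ge0 ?ltW //; lra.
split; first by lra.
by rewrite ler_norml; apply/andP; split; lra.
Qed.

(** Serves to derive [3888 ^ 2 <= 59 ^ 5] through the intermediate values 66 and 80, so that only
    numbers below five thousand are evaluated. *)
Lemma fifth_power_bound (p t x y : int) :
  0 <= p -> 0 <= t -> p <= t * x -> x * x <= t * y -> y <= t * t ->
  p * p <= t * t * t * t * t.
Proof.
move=> p0 t0 px xy yt; apply: le_trans (ler_pM p0 p0 px px) _.
have -> : t * x * (t * x) = t * t * (x * x) by ring.
have -> : t * t * t * t * t = t * t * (t * (t * t)) by ring.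
rewrite ler_wpM2l ?mulr_ge0 // (le_trans xy) // ler_wpM2l //.
Qed.

(* The hypotheses say [2 (G + i H) ^ 4 = (1 - 239 i) (k + i T)], so that the angle of
   [G + i H] is, up to [O(G ^ -4)], a quarter of [atan (1 / 239)]; the linear forms
   of [linear_form_bound] forbid such a good approximation when [G] is large. *)
Lemma thue_solution_bound (R : rcfType) (G H k T : int) :
  0 < G -> `|H| <= G -> `|k| <= 4 -> 0 < T ->
  2 * (G ^+ 4 - 6 * G ^+ 2 * H ^+ 2 + H ^+ 4) = k + 239 * T ->
  8 * G * H * (G ^+ 2 - H ^+ 2) = T - 239 * k ->
  G <= (240 * 3888) ^+ 2.
Proof.
move=> G0 HG k4 T0 re im.
have [M [s [c [[M0 M2 s0 c0 sc1] [Mcos Msin sl]]]]] := small_angle R.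
have [s600 c999 c1 M240] := small_angle_bounds M0 M2 s0 c0 sc1 Mcos sl.
have [a [b [a0 b0 a1 b1 rec]]] := thue_sequences.
have ra : thue_recurrence a by move=> m; have [] := rec m.
have rb : thue_recurrence b by move=> m; have [] := rec m.
have lin n : `|(a n)%:~R * s - (b n)%:~R * c| * 59 ^+ n <= s.
  exact: (linear_form_bound (M := M)).
pose Gr : R := G%:~R; pose Hr : R := H%:~R.
have Gr1 : 1 <= Gr by rewrite ler1z -gtz0_ge1.
have HGr : `|Hr| <= Gr by rewrite -intr_norm ler_int.
(* [g + i l] is [G + i H] rotated back by the angle with sine [s] and cosine [c]; in these
   coordinates [2 (g + i l) ^ 4 = M (T - i k)]. *)
pose g := Gr * c + Hr * s; pose l := Hr * c - Gr * s.
have Mc4 : M * (c ^+ 4 - 6 * c ^+ 2 * s ^+ 2 + s ^+ 4) = 239.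
  rewrite -[RHS]Mcos; congr (_ * _); have cc : c * c = 1 - s * s by rewrite -sc1 addrAC subrr add0r.
  by transitivity ((c * c) * (c * c) - 6 * (c * c) * (s * s) + s ^+ 4); [ring|rewrite cc; ring].
have Ms4 : M * (4 * s * c * (c ^+ 2 - s ^+ 2)) = 1.
  rewrite -[RHS]Msin; congr (_ * (_ * _)); have cc : c * c = 1 - s * s by rewrite -sc1 addrAC subrr add0r.
  by rewrite expr2 cc; ring.
have M2' : M * M = 239 * 239 + 1 := M2.
have reR : 2 * (Gr ^+ 4 - 6 * Gr ^+ 2 * Hr ^+ 2 + Hr ^+ 4) = k%:~R + 239 * T%:~R.
  by transitivity ((2 * (G ^+ 4 - 6 * G ^+ 2 * H ^+ 2 + H ^+ 4))%:~R : R); [rewrite /Gr /Hr; ring|rewrite re; ring].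
have imR : 8 * Gr * Hr * (Gr ^+ 2 - Hr ^+ 2) = T%:~R - 239 * k%:~R.
  by transitivity ((8 * G * H * (G ^+ 2 - H ^+ 2))%:~R : R); [rewrite /Gr /Hr; ring|rewrite im; ring].
have Mn0 : M != 0 by rewrite lt0r_neq0.
have gl2 : 2 * (g ^+ 4 - 6 * g ^+ 2 * l ^+ 2 + l ^+ 4) = M * T%:~R.
  apply: (mulfI Mn0).
  transitivity (2 * (Gr ^+ 4 - 6 * Gr ^+ 2 * Hr ^+ 2 + Hr ^+ 4) * (M * (c ^+ 4 - 6 * c ^+ 2 * s ^+ 2 + s ^+ 4))
     + 8 * Gr * Hr * (Gr ^+ 2 - Hr ^+ 2) * (M * (4 * s * c * (c ^+ 2 - s ^+ 2)))).
    by rewrite /g /l; ring.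
  by rewrite Mc4 Ms4 reR imR mulrA M2'; ring.
have gl3 : 8 * g * l * (g ^+ 2 - l ^+ 2) = - M * k%:~R.
  apply: (mulfI Mn0).
  transitivity (8 * Gr * Hr * (Gr ^+ 2 - Hr ^+ 2) * (M * (c ^+ 4 - 6 * c ^+ 2 * s ^+ 2 + s ^+ 4))
    - 2 * (Gr ^+ 4 - 6 * Gr ^+ 2 * Hr ^+ 2 + Hr ^+ 4) * (M * (4 * s * c * (c ^+ 2 - s ^+ 2)))).
    by rewrite /g /l; ring.
  by rewrite Mc4 Ms4 reR imR mulNr mulrN mulrA M2'; ring.
have [gG lG] := rotation_bounds Gr1 HGr s0 c0 s600 c999 c1.
rewrite -/g -/l in gG lG.
have gG' : 9 / 10 * Gr <= g by move: gG Gr1; clear; move: (g) (Gr) => x y; lra.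
clear M2 M2' Mcos Msin sl sc1 Mc4 Ms4 reR imR.
have k4R : (-4 : R) <= (k%:~R : R) <= (4 : R).
  have : `|k%:~R : R| <= 4 by rewrite -intr_norm (ler_int _ _ 4).
  by rewrite ler_norml.
have g0 : 0 < g by apply: lt_le_trans gG'; rewrite mulr_gt0 ?(lt_le_trans _ Gr1) // divr_gt0.
have lg : `|l| <= 11 / 10 * g by move: gG lG Gr1; clear; move: (`|l|) (g) (Gr) => x y z; lra.
have re0 : 0 < 2 * (g ^+ 4 - 6 * g ^+ 2 * l ^+ 2 + l ^+ 4) by rewrite gl2 mulr_gt0 // ltr0z.
have close := thue_close_form M0 M240 k4R g0 lg re0 gl3.
have closeG : `|l| * Gr ^+ 3 <= 210.
  have h : `|l| * (9 / 10 * Gr) ^+ 3 <= `|l| * g ^+ 3.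
    rewrite ler_wpM2l // lerXn2r // nnegrE; last by apply: le_trans gG'; rewrite mulr_ge0 // ?divr_ge0 // (le_trans _ Gr1).
    by rewrite mulr_ge0 // ?divr_ge0 // (le_trans _ Gr1).
  have E : `|l| * (9 / 10 * Gr) ^+ 3 = 729 / 1000 * (`|l| * Gr ^+ 3) by field.
  rewrite E in h; move: (`|l| * Gr ^+ 3) (`|l| * g ^+ 3) h close; clear; move=> u v; lra.
have [n [n1 n2]] : exists n, 59 ^+ n <= G /\ G < 59 ^+ n.+1.
  exists (trunc_log 59 `|G|%N).
  have /andP[] : (59 ^ trunc_log 59 `|G| <= `|G| < 59 ^ (trunc_log 59 `|G|).+1)%N.
    by apply: trunc_log_bounds => //; rewrite absz_gt0 lt0r_neq0.
  have PX i : (59 ^ i)%N = 59 ^+ i :> int by rewrite -natz natrX.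
  by rewrite -lez_nat -ltz_nat !gtz0_abs // !PX.
have [j [nj jn dj]] : exists j, [/\ (n <= j)%N, (j <= n.+1)%N & a j * H - b j * G != 0].
  case: (eqVneq (a n * H - b n * G) 0) => [E0|]; last by exists n.
  exists n.+1; split=> //; apply/negP => /eqP E1.
  have : (a n * b n.+1 - a n.+1 * b n) * G = 0.
    transitivity (a n.+1 * (a n * H - b n * G) - a n * (a n.+1 * H - b n.+1 * G)); first by ring.
    by rewrite E0 E1 !mulr0 subrr.
  by apply/eqP/mulf_neq0; [exact: thue_det_neq0|exact: lt0r_neq0].
have /andP[aj0 aj1] := thue_re_bound a0 a1 ra j.
pose e := (a j)%:~R * s - (b j)%:~R * c.
have lin_j : `|e| * 59 ^+ j <= s := lin j.
have Gr59 : Gr <= 59 * 59 ^+ j.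
  rewrite -exprS (le_trans (_ : _ <= 59 ^+ n.+1)) //.
    by have := ltW n2; rewrite -(ler_int R) rmorphXn.
  by rewrite ler_weXn2l // ler1n.
have Ge : Gr * `|e| <= 1 / 10.
  have h : Gr * `|e| <= 59 * 59 ^+ j * `|e| by rewrite ler_wpM2r.
  apply: le_trans h _; rewrite -mulrA [_ * `|e|]mulrC.
  by move: lin_j s600; clear; move: (`|e| * 59 ^+ j) => x; lra.
(* The left-hand combination is [c] times a nonzero integer. As [Gr * |e|] is at most [59 / 600],
   the term in [l] must carry the rest, which makes [a j] at least of order [G ^ 3]. *)
have D1 : c <= `|(a j)%:~R * l + Gr * e|.
  have -> : (a j)%:~R * l + Gr * e = c * (a j * H - b j * G)%:~R by rewrite /e /l /Gr /Hr; ring.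
  rewrite normrM (gtr0_norm c0) -[leLHS]mulr1 ler_wpM2l ?(ltW c0) // -intr_norm.
  by rewrite (ler_int _ 1) -gtz0_ge1 normr_gt0.
have A1 : 89 / 100 <= (a j)%:~R * `|l|.
  have := le_trans D1 (ler_normD _ _); rewrite !normrM (ger0_norm (le_trans ler01 Gr1)).
  rewrite (gtr0_norm (_ : 0 < (a j)%:~R)) ?ltr0z //.
  by move: Ge c999; clear; move: ((a j)%:~R * `|l|) (Gr * `|e|) => x y; lra.
have A2 : Gr ^+ 3 <= (240 * a j)%:~R.
  have Gr3 : 0 <= Gr ^+ 3 by rewrite exprn_ge0 // (le_trans ler01 Gr1).
  have h1 : 89 / 100 * Gr ^+ 3 <= (a j)%:~R * (`|l| * Gr ^+ 3) by rewrite [leRHS]mulrA ler_wpM2r.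
  have h2 : (a j)%:~R * (`|l| * Gr ^+ 3) <= (a j)%:~R * 210 by rewrite ler_wpM2l // ler0z ltW.
  rewrite rmorphM /= (_ : (240 : int)%:~R = 240) //.
  have h3 : 0 <= (a j)%:~R :> R by rewrite ler0z ltW.
  by move: h1 h2 h3; clear; move: ((a j)%:~R * (`|l| * Gr ^+ 3)) (Gr ^+ 3) ((a j)%:~R) => x y z; lra.
have {}A2 : G ^+ 3 <= 240 * a j by rewrite -(ler_int R) rmorphXn.
have p2 : 3888 * 3888 <= 59 * 59 * 59 * 59 * 59 :> int.
  have h1 : 3888 <= 59 * 66 :> int by rewrite -natrM ler_nat.
  have h2 : 66 * 66 <= 59 * 80 :> int by rewrite -!natrM ler_nat.
  have h3 : 80 <= 59 * 59 :> int by rewrite -natrM ler_nat.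
  exact: (fifth_power_bound (ler0n _ _) (ler0n _ _) h1 h2 h3).
have p1 : 1 <= 3888 :> int by rewrite (ler1n int 3888); exact: (isT : (0 < 3888)%N).
have t0 : 0 <= 59 :> int by rewrite ler0n.
have q0 : 0 <= 240 :> int by rewrite ler0n.
clear - G0 n1 jn aj1 A2 p2 p1 t0 q0.
move: n1 aj1 A2 p2 p1 t0 q0; move: (240 : int) (3888 : int) (59 : int) => q p t n1 aj1 A2 p2 p1 t0 q0.
have p0 : 0 <= p := le_trans ler01 p1.
have A3 : G ^+ 3 <= q * p * p ^+ n.
  by apply: le_trans A2 _; rewrite -mulrA ler_wpM2l // -exprS (le_trans aj1) // ler_weXn2l.
(* The decisive inequality [3888 ^ 2 <= 59 ^ 5] enters here: the square of [A3] has [G ^ 6] on the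
   left and only [G ^ 5] on the right. *)
have A4 : (p ^+ n) ^+ 2 <= G ^+ 5.
  apply: (le_trans (_ : _ <= (t ^+ n) ^+ 5)); last by rewrite lerXn2r // nnegrE ?exprn_ge0 // ltW.
  rewrite -!exprM mulnC (mulnC n) !exprM lerXn2r // ?nnegrE ?exprn_ge0 //.
  by rewrite expr2 (_ : t ^+ 5 = t * t * t * t * t) //; ring.
have A5 : G * G ^+ 5 <= (q * p) ^+ 2 * G ^+ 5.
  rewrite -exprS (exprM G 3 2).
  apply: (le_trans (_ : _ <= (q * p * p ^+ n) ^+ 2)).
    by rewrite lerXn2r // nnegrE ?exprn_ge0 // ?(ltW G0) // !mulr_ge0 ?exprn_ge0.
  by rewrite exprMn ler_wpM2l // sqr_ge0.
by move: A5; rewrite ler_pM2r // exprn_gt0.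
Qed.

(** * Fermat's and Ljunggren's quartic equations *)

Lemma coprime_mul_square (a b c : nat) :
  coprime a b -> (a * b = c * c)%N -> exists d, a = (d * d)%N.
Proof.
move=> cab abc; have [d0|d0] := posnP (gcdn a c).
  by exists 0%N; apply/eqP; rewrite -dvd0n -d0 dvdn_gcdl.
exists (gcdn a c); set d := gcdn a c in d0 *.
have /dvdnP[a' aE] : (d %| a)%N := dvdn_gcdl a c.
have /dvdnP[c' cE] : (d %| c)%N := dvdn_gcdr a c.
have cop : coprime a' c'.
  by rewrite /coprime -(eqn_pmul2r d0) muln_gcdl -aE -cE mul1n.
have E : (a' * b = d * (c' * c'))%N.
  by apply/eqP; rewrite -(eqn_pmul2l d0); apply/eqP; move: abc; rewrite aE cE; lia.
have h1 : (a' %| d)%N.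
  by rewrite -(Gauss_dvdl d (p := c' * c')) ?coprimeMr ?cop // -E dvdn_mulr.
have h2 : (d %| a')%N.
  rewrite -(Gauss_dvdl a' (p := b)) ?E ?dvdn_mulr //.
  by apply: coprime_dvdl cab; apply: dvdn_gcdl.
by rewrite {1}aE; congr (_ * _)%N; apply/eqP; rewrite eqn_dvd h1 h2.
Qed.

Lemma coprimez_mul_square (a b c : int) :
  0 <= a -> coprimez a b -> a * b = c * c -> exists d : int, a = d * d.
Proof.
move=> a0 cab abc.
have [d dE] : exists d, `|a|%N = (d * d)%N.
  by apply: (@coprime_mul_square _ `|b| `|c|) => //; rewrite -!abszM abc.
by exists d; rewrite -(gez0_abs a0) dE PoszM.
Qed.

Lemma pythagorean_triple (x y z : int) :
  0 <= z -> coprimez x z -> x * x + 2 * y * (2 * y) = z * z ->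
  exists m n : int, [/\ x = m * m - n * n, y = m * n, z = m * m + n * n & coprimez m n].
Proof.
move=> z0 cxz E.
have [u [v [xE zE]]] : exists u v, x = u - v /\ z = u + v.
  have [i hi] : exists i, x = 2 * i \/ x = 2 * i + 1 by exists (x %/ 2)%Z; lia.
  have [k hk] : exists k, z = 2 * k \/ z = 2 * k + 1 by exists (z %/ 2)%Z; lia.
  by case: hi hk E => -> [] -> E; [exists (k + i), (k - i)|nia|nia|exists (k + i + 1), (k - i)]; split; ring.
have uv : u * v = y * y by move: E; rewrite xE zE; lia.
have cuv : coprimez u v.
  apply/coprimezP; have /coprimezP[[p q] /= pq] := cxz.
  by exists (p + q, q - p) => /=; rewrite -pq xE zE; ring.
have [u0 v0] : 0 <= u /\ 0 <= v by nia.
have [m mE] := coprimez_mul_square u0 cuv uv.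
have [n nE] : exists n, v = n * n.
  by apply: (coprimez_mul_square v0 _ (c := y)); [rewrite coprimez_sym; exact: cuv|rewrite mulrC].
have cmn : coprimez m n.
  move: cuv; rewrite mE nE !coprimezMl !coprimezMr.
  by case/andP => /andP[].
have : (m * n - y) * (m * n + y) = 0 by move: uv; rewrite mE nE; lia.
move=> /eqP; rewrite mulf_eq0 => /orP[]/eqP h.
  by exists m, n; split=> //; lia.
by exists m, (- n); rewrite coprimezN; split=> //; lia.
Qed.

Lemma coprimez_addMl (m k x : int) : coprimez m k -> coprimez m (m * x + k).
Proof.
move=> /coprimezP[[u v] /= uv]; apply/coprimezP; exists (u - v * x, v) => /=.
by rewrite -uv; ring.
Qed.

Lemma parityz (x : int) : exists i, x = 2 * i \/ x = 2 * i + 1.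
Proof. by exists (x %/ 2)%Z; lia. Qed.

(** Fermat's descent on [|a|]: two successive parametrisations of Pythagorean triples, with coprime
    factors of squares being squares, produce a solution [F, h, r] of the same equation with
    [|F| < |a|]. *)
Lemma fermat_quartic (a b c : int) :
  coprimez a (2 * b) -> a * a * (a * a) = 2 * b * (2 * b) * (2 * b * (2 * b)) + c * c -> b = 0.
Proof.
have [N] := ubnP `|a|%N; elim: N a b c => // N IH a b c aN cab E.
wlog a0 : a aN cab E / 0 <= a.
  move=> W; case: (leP 0 a) => h; first exact: (W a).
  by apply: (W (- a)); rewrite ?abszN ?coprimeNz ?mulrNN //; lia.
have [//|b0] := eqVneq b 0.
have [m [n [cE bE aE cmn]]] : exists m n, [/\ c = m * m - n * n, 2 * (b * b) = m * n,
    a * a = m * m + n * n & coprimez m n].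
  apply: pythagorean_triple; first by rewrite -expr2 sqr_ge0.
    have : coprimez a (c * c).
      have -> : c * c = a * (a * (a * a)) + - (2 * b * (2 * b) * (2 * b * (2 * b))).
        by rewrite mulrA E; ring.
      apply: coprimez_addMl; rewrite coprimezN.
      by move: (2 * b) cab => x h; rewrite !coprimezMr h.
    by rewrite coprimezMr andbb coprimez_sym coprimezMr => ->.
  by rewrite E; ring.
(* Exactly one of [m], [n] is even; [key] treats both possibilities, with the even one written
   [2 * n']. *)
have key m' n' : 2 * (b * b) = m' * (2 * n') -> a * a = m' * m' + 2 * n' * (2 * n') ->
    coprimez m' (2 * n') -> False.
  move=> {c cE bE aE cmn m n E} bE aE cmn.
  wlog m0 : m' n' bE aE cmn / 0 <= m'.
    move=> W; case: (leP 0 m') => h; first exact: (W m' n').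
    by apply: (W (- m') (- n')); rewrite ?mulrN ?coprimeNz ?coprimezN ?mulrNN //; lia.
  have bb : m' * n' = b * b by lia.
  have n0 : 0 < n' by nia.
  have [f [g [mE nE aE' cfg]]] : exists f g, [/\ m' = f * f - g * g, n' = f * g,
      a = f * f + g * g & coprimez f g].
    apply: pythagorean_triple; [by []| |by []].
    have : coprimez m' (a * a) by rewrite aE; apply: coprimez_addMl; rewrite coprimezMr cmn.
    by rewrite coprimezMr => /andP[].
  wlog f0 : f g mE nE aE' cfg / 0 <= f.
    move=> W; case: (leP 0 f) => h; first exact: (W f g).
    by apply: (W (- f) (- g)); rewrite ?mulrNN ?coprimeNz ?coprimezN //; lia.
  have {}f0 : 0 < f by nia.
  have g0 : 0 < g by nia.
  have cmn' : coprimez m' n' by move: cmn; rewrite coprimezMr => /andP[].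
  have [r rE] := coprimez_mul_square m0 cmn' bb.
  have [s sE] : exists s, n' = s * s.
    by apply: (coprimez_mul_square (ltW n0) _ (b := m') (c := b)); [rewrite coprimez_sym|rewrite mulrC].
  have fg : f * g = s * s by rewrite -nE.
  have [F FE] := coprimez_mul_square (ltW f0) cfg fg.
  have [G GE] : exists G, g = G * G.
    by apply: (coprimez_mul_square (ltW g0) _ (b := f) (c := s)); [rewrite coprimez_sym|rewrite mulrC].
  have r_odd : exists i, r = 2 * i + 1.
    have [i [ri|]] := parityz r; last by exists i.
    move: cmn; rewrite rE ri !coprimezMl -!andbA => /andP[].
    by rewrite coprimezMr => /andP[].
  have FG : F * F * (F * F) = G * G * (G * G) + r * r by rewrite -FE -GE -rE mE; ring.
  have [h Gh] : exists h, G = 2 * h.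
    have [i ri] := r_odd; have [h [|Gh]] := parityz G; first by exists h.
    have [j [Fj|Fj]] := parityz F; move: FG; rewrite ri Gh Fj; lia.
  have h0 : h = 0.
    apply: (IH F h r).
    - have : `|F|%:Z < `|a|%:Z; last by lia.
      have : 0 < F * F by rewrite -FE.
      have : `|F| <= F * F by clear; nia.
      have : F * F <= f * f by move: f0; rewrite FE; clear; move: (F * F) => x; nia.
      by move: aE' g0; clear; nia.
    - have : coprimez (F * F) (G * G) by rewrite -FE -GE.
      by rewrite Gh coprimezMl => /andP[cF _]; move: cF; rewrite (coprimezMr F (2 * h) (2 * h)) => /andP[].
    - by rewrite FG Gh.
  by move: g0; rewrite GE Gh h0 mulr0.
have [i [mi|mi]] := parityz m.
  case: (key n i); [by rewrite bE mi mulrC|by rewrite aE mi addrC|by rewrite -mi coprimez_sym].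
have [j [nj|nj]] := parityz n; last by move: bE; rewrite mi nj; lia.
by case: (key m j); rewrite -?nj.
Qed.

(** [w ^ 4 + ((w ^ 4 - 1) / 2) ^ 2 = y ^ 4] is a Pythagorean triple, and its parameters satisfy
    [p ^ 4 - q ^ 4 = (w y) ^ 2] with [q] even, which Fermat's theorem forces to be trivial. *)
Lemma quartic_sum_one (w y : int) : w * w * (w * w) + 1 = 2 * (y * y) -> w * w = 1.
Proof.
move=> E.
have [i wi] : exists i, w = 2 * i + 1.
  by have [i [wi|]] := parityz w; [move: E; rewrite wi; lia|exists i].
have [e eE] : exists e, w * w * (w * w) - 1 = 2 * (2 * e).
  by exists (4 * i * i * i * i + 8 * i * i * i + 6 * i * i + 2 * i); rewrite wi; ring.
have [p [q [wE eE' yE cpq]]] : exists p q, [/\ w * w = p * p - q * q, e = p * q,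
    y * y = p * p + q * q & coprimez p q].
  apply: pythagorean_triple; first by rewrite -expr2 sqr_ge0.
    apply/coprimezP; exists (- (w * w), 2) => /=; lia.
  nia.
have [h qh] : exists h, q = 2 * h.
  have [h [|qh]] := parityz q; first by exists h.
  by have [k [pk|pk]] := parityz p; move: wE; rewrite wi qh pk; lia.
have h0 : h = 0.
  apply: (@fermat_quartic p h (w * y)); first by rewrite -qh.
  have -> : w * y * (w * y) = (w * w) * (y * y) by ring.
  rewrite wE yE -qh; ring.
by move: eE; rewrite eE' qh h0; nia.
Qed.

(** * Enumeration of the solutions of [t ^ 2 + 1 = 2 y ^ 2], in binary integers for computation *)

Section PellZ.
Local Open Scope Z_scope.

(** The coordinates of [(1 + √2) (3 + 2 √2) ^ n]. *)
Fixpoint pell (n : nat) : Z * Z :=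
  if n is n'.+1
  then let p := pell n' in (3 * p.1 + 4 * p.2, 2 * p.1 + 3 * p.2)
  else (1, 1).

Lemma pellS n :
  pell n.+1 = (3 * (pell n).1 + 4 * (pell n).2, 2 * (pell n).1 + 3 * (pell n).2).
Proof. by []. Qed.

Lemma pell_complete (t y : Z) : 0 < t -> 0 < y -> t * t + 1 = 2 * (y * y) ->
  exists n, pell n = (t, y).
Proof.
have [N] := ubnP (Z.to_nat y); elim: N t y => // N IH t y yN t0 y0 E.
have [y1|y1] := Z.eq_dec y 1.
  by exists 0%nat; rewrite /= y1; congr (_, _); nia.
have [n nE] : exists n, pell n = (3 * t - 4 * y, 3 * y - 2 * t).
  have h1 : 2 * t < 3 * y by nia.
  have h2 : y < t by nia.
  by apply: IH; [lia|nia|lia|nia].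
by exists n.+1; rewrite pellS nE; cbv beta iota delta [fst snd]; congr pair; lia.
Qed.

Lemma pell_growth n : [/\ 0 < (pell n).1, (pell n).2 <= (pell n).1 & 4 ^ Z.of_nat n <= (pell n).2].
Proof.
elim: n => [//|n]; rewrite Nat2Z.inj_succ Z.pow_succ_r; last by lia.
rewrite pellS; case: (pell n) => t y; cbv beta iota delta [fst snd].
have := Z.pow_nonneg 4 (Z.of_nat n) ltac:(lia).
by move: (4 ^ _) => x x0 [t0 ty IH]; split; lia.
Qed.

Definition pell_square (n : nat) : bool :=
  let y := (pell n).2 in let s := Z.sqrt y in s * s =? y.

Lemma pell_square_small :
  all (fun n => ~~ pell_square n || (n == 0%nat) || (n == 3%nat)) (iota 0 80).
Proof. by vm_compute. Qed.

(** By [pell_growth], [y = r ^ 2 < 4 ^ 80] has index below 80; the squares there are [1] at index 0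
    and [169] at index 3. *)
Lemma pell_square_le (t r : Z) : 0 < t -> 0 < r -> r < 4 ^ 40 ->
  t * t + 1 = 2 * (r * r * (r * r)) -> r = 1 \/ r = 13.
Proof.
move=> t0 r0 rK E.
have [n nE] := pell_complete t0 (Z.mul_pos_pos _ _ r0 r0) E.
have [_ _ hn] := pell_growth n; rewrite nE /= in hn.
have n80 : (n < 80)%nat.
  have h : 4 ^ Z.of_nat n < 4 ^ 80.
    apply: Z.le_lt_trans hn _; rewrite (Z.pow_add_r 4 40 40) //; nia.
  by have := Z.pow_lt_mono_r_iff 4 (Z.of_nat n) 80; lia.
have sq : pell_square n.
  by rewrite /pell_square nE /= Z.sqrt_square; lia.
have /allP/(_ n) := pell_square_small; rewrite mem_iota sq /= => /(_ n80).
by move=> /orP[]/eqP n03; move: nE; rewrite n03; vm_compute pell; case => _; nia.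
Qed.
End PellZ.

(* [(1 - i) (m + n i) ^ 4 = thue_form m n + i (thue_coform m n)] *)
Definition thue_form (m n : int) : int :=
  m ^+ 4 + 4 * m ^+ 3 * n - 6 * m ^+ 2 * n ^+ 2 - 4 * m * n ^+ 3 + n ^+ 4.

Definition thue_coform (m n : int) : int :=
  4 * m ^+ 3 * n - 4 * m * n ^+ 3 - (m ^+ 4 - 6 * m ^+ 2 * n ^+ 2 + n ^+ 4).

(** Modulo 4 the form is the square of [m ^ 2 - n ^ 2], and [- 1] is not a square modulo 4. *)
Lemma thue_form_neqN1 m n : thue_form m n <> - 1.
Proof.
have -> : thue_form m n = (m * m - n * n) * (m * m - n * n)
  + 4 * (m ^+ 3 * n - m ^+ 2 * n ^+ 2 - m * n ^+ 3) by rewrite /thue_form; ring.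
move: (_ - _ - _) (_ - _) => x y.
by have [i [-> | ->]] := parityz y; lia.
Qed.

(** With [t = 2 k + 1], the numbers [k], [k + 1], [r ^ 2] form a Pythagorean triple. Parametrising
    it by [p], [q], and then the triple [p], [q], [r], writes the difference of the first two legs
    as the quartic form up to sign; [thue_form_neqN1] settles the sign. *)
Lemma ljunggren_thue_form (t r : int) : 0 <= r -> t * t + 1 = 2 * (r * r * (r * r)) ->
  exists m n, r = m * m + n * n /\ thue_form m n = 1.
Proof.
move=> r0 E.
have [p [q [pqE rE cpq]]] : exists p q : int, [/\ p * p - q * q - 2 * (p * q) = 1 \/ p * p - q * q - 2 * (p * q) = - 1,
    r * r = p * p + q * q & coprimez p q].
  have [k tk] : exists k, t = 2 * k + 1.
    by have [k [tk|]] := parityz t; [move: E; rewrite tk; lia|exists k].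
  have rr0 : 0 <= r * r by rewrite mulr_ge0.
  have E' : k * k + (k + 1) * (k + 1) = r * r * (r * r) by move: E; rewrite tk; lia.
  have [j [kj|kj]] := parityz k.
    have [||p [q [xE yE zE c]]] := @pythagorean_triple (k + 1) j (r * r) rr0.
      have : coprimez (k + 1) (r * r * (r * r)).
        have -> : r * r * (r * r) = (k + 1) * (k + 1) + k * k by rewrite -E'; ring.
        apply: coprimez_addMl; rewrite coprimezMr andbb.
        by apply/coprimezP; exists (1, - 1) => /=; ring.
      by rewrite coprimezMr andbb.
    by rewrite -E' kj; ring.
    by exists p, q; split=> //; left; rewrite -xE -yE kj; ring.
  have [||p [q [xE yE zE c]]] := @pythagorean_triple k (j + 1) (r * r) rr0.
      have : coprimez k (r * r * (r * r)).
        rewrite -E'; apply: coprimez_addMl; rewrite coprimezMr andbb.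
        by apply/coprimezP; exists (- 1, 1) => /=; ring.
      by rewrite coprimezMr andbb.
    by rewrite -E' kj; ring.
  by exists p, q; split=> //; right; rewrite -xE -yE kj; ring.
have crE (x y : int) : coprimez x y -> r * r = x * x + y * y -> coprimez x r.
  move=> cxy rr; have : coprimez x (r * r).
    by rewrite rr; apply: coprimez_addMl; rewrite coprimezMr andbb.
  by rewrite coprimezMr andbb.
have [j [qj|qj]] := parityz q.
  have [||m [n [xE yE zE _]]] := @pythagorean_triple p j r r0; first exact: crE cpq rE.
    by rewrite rE qj.
  exists m, (- n); split; first by rewrite zE; ring.
  have -> : thue_form m (- n) = p * p - q * q - 2 * (p * q).
    by rewrite qj xE yE /thue_form; ring.
  have := @thue_form_neqN1 m (- n).
  have -> : thue_form m (- n) = p * p - q * q - 2 * (p * q).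
    by rewrite qj xE yE /thue_form; ring.
  by case: pqE.
have [i [pi|pi]] := parityz p; last first.
  by have [h [rh|rh]] := parityz r; move: rE; rewrite qj pi rh; lia.
have [||m [n [xE yE zE _]]] := @pythagorean_triple q i r r0.
- by apply: (crE q p); [rewrite coprimez_sym|rewrite rE addrC].
- by rewrite rE pi addrC.
exists m, n; split; first by [].
have FE : - thue_form m n = p * p - q * q - 2 * (p * q) by rewrite pi xE yE /thue_form; ring.
have := @thue_form_neqN1 m n; move: FE pqE => <- []; lia.
Qed.

Definition thue_radius : int := (240 * 3888) ^+ 2.

(** Multiplying [x + i y] by a power of the imaginary unit preserves both quartic expressions and
    brings the coordinate of larger absolute value, made positive, to the front. *)
Lemma rotated_bound (x y k T : int) :
  `|k| <= 4 -> 0 < T ->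
  2 * (x ^+ 4 - 6 * x ^+ 2 * y ^+ 2 + y ^+ 4) = k + 239 * T ->
  8 * x * y * (x ^+ 2 - y ^+ 2) = T - 239 * k ->
  `|x| <= thue_radius /\ `|y| <= thue_radius.
Proof.
move=> k4 T0 re im.
have key G H : `|H| <= G ->
    2 * (G ^+ 4 - 6 * G ^+ 2 * H ^+ 2 + H ^+ 4) = k + 239 * T ->
    8 * G * H * (G ^+ 2 - H ^+ 2) = T - 239 * k -> `|H| <= G /\ G <= thue_radius.
  move=> HG re' im'; split=> //; apply: (@thue_solution_bound realalg G H k T) => //.
  have := le_trans (normr_ge0 H) HG; rewrite le_eqVlt => /orP[/eqP G0|//].
  by move: HG re'; rewrite -G0 normr_le0 => /eqP ->; lia.
move: thue_radius key => K key.
have [yx|xy] := lerP `|y| `|x|.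
  have [x0|x0] := lerP 0 x.
    have [|//|//|h1 h2] := key x y; first by rewrite -(ger0_norm x0).
    by rewrite (ger0_norm x0); split=> //; apply: le_trans h2.
  have [||//|h1 h2] := key (- x) (- y); first by rewrite normrN -(ltr0_norm x0).
  - by rewrite -re; ring.
  - by rewrite -im; ring.
  by rewrite (ltr0_norm x0); split=> //; rewrite normrN in h1; apply: le_trans h2.
have {}xy := ltW xy.
have [y0|y0] := lerP 0 y.
  have [||//|h1 h2] := key y (- x); first by rewrite normrN -(ger0_norm y0).
  - by rewrite -re; ring.
  - by rewrite -im; ring.
  by rewrite (ger0_norm y0); split=> //; rewrite normrN in h1; apply: le_trans h2.
have [||//|h1 h2] := key (- y) x; first by rewrite -(ltr0_norm y0).
- by rewrite -re; ring.
- by rewrite -im; ring.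
by rewrite (ltr0_norm y0); split=> //; apply: le_trans h2.
Qed.

(* [rotated_bound] is applied to [(3 - 2 i) (m + n i)], or to [(5 + i) (m + n i)] when
   the coform is negative, since
   [2 (3 - 2 i) ^ 4 = (1 - 239 i) (1 - i)] and [(5 + i) ^ 4 = 2 (1 - 239 i) (i - 1)]. *)
Lemma thue_norm_bound (m n : int) : thue_form m n = 1 ->
  (m * m + n * n) * 13 <= thue_radius ^+ 2 * 2.
Proof.
have := rotated_bound; move: thue_radius => K rb F1.
have co2 : thue_coform m n * thue_coform m n = 2 * (m * m + n * n) ^+ 4 - thue_form m n * thue_form m n.
  by rewrite /thue_coform /thue_form; ring.
have co0 : thue_coform m n != 0.
  apply/eqP => E; move: co2; rewrite E F1; move: (_ ^+ 4) => z; lia.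
have [a [x [y [xK yK xy a1]]]] : exists a x y : int, [/\ `|x| <= K, `|y| <= K,
    x * x + y * y = a * (m * m + n * n) & 13 <= a].
  have [T0|T0|T0] := ltrgtP (thue_coform m n) 0; last by rewrite T0 eqxx in co0.
    have [||||h1 h2] := rb (5 * m - n) (m + 5 * n) (- 4) (- 4 * thue_coform m n) => //.
    - lia.
    - transitivity (- 4 * thue_form m n + 239 * (- 4 * thue_coform m n)); last by rewrite F1.
      by rewrite /thue_form /thue_coform; ring.
    - transitivity (- 4 * thue_coform m n - 239 * (- 4 * thue_form m n)); last by rewrite F1.
      by rewrite /thue_form /thue_coform; ring.
    exists 26, (5 * m - n), (m + 5 * n); split=> //; ring.
  have [||||h1 h2] := rb (3 * m + 2 * n) (3 * n - 2 * m) 1 (thue_coform m n) => //.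
  - transitivity (thue_form m n + 239 * (thue_coform m n)); last by rewrite F1.
    by rewrite /thue_form /thue_coform; ring.
  - transitivity (thue_coform m n - 239 * (thue_form m n)); last by rewrite F1.
    by rewrite /thue_form /thue_coform; ring.
  exists 13, (3 * m + 2 * n), (3 * n - 2 * m); split=> //; ring.
have sq z : `|z| <= K -> z * z <= K ^+ 2.
  move=> zK; rewrite -expr2 -real_normK ?num_real // lerXn2r ?nnegrE //.
  exact: le_trans zK.
have := sq _ xK; have := sq _ yK; have : 0 <= m * m + n * n by rewrite -!expr2 addr_ge0 ?sqr_ge0.
by move: xy a1; move: (m * m + n * n) (x * x) (y * y) (K ^+ 2); clear; nia.
Qed.

Lemma ljunggren (t r : int) : 0 < r -> t * t + 1 = 2 * (r * r * (r * r)) -> r = 1 \/ r = 13.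
Proof.
move=> r0 E.
have [m [n [rE F1]]] := ljunggren_thue_form (ltW r0) E.
have := thue_norm_bound F1; rewrite -rE => rK.
have rK' : Z.lt (Z_of_int r) (Z.pow 4 40).
  by move: rK; rewrite /thue_radius !expr2; clear; lia.
have t0 : t != 0 by apply/eqP => t0; move: E; rewrite t0; lia.
have := @pell_square_le (Z.abs (Z_of_int t)) (Z_of_int r).
lia.
Qed.

(** * Elements of relative norm 2 + √2 in Z[√2][√(-1-√2)] *)

(* [(p, q, r, s)] stands for [(p + q √2) + (r + s √2) w] with [w ^ 2 = - (1 + √2)]. *)
Definition quartic := (int * int * int * int)%type.

Definition qmul (x y : quartic) : quartic :=
  let: (p, q, r, s) := x in let: (p', q', r', s') := y in
  let c := r * r' + 2 * s * s' in let d := r * s' + s * r' in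
  (p * p' + 2 * q * q' - (c + 2 * d), p * q' + q * p' - (c + d),
   p * r' + 2 * q * s' + r * p' + 2 * s * q', p * s' + q * r' + r * q' + s * p').

Lemma eq_quartic (p q r s p' q' r' s' : int) :
  p = p' -> q = q' -> r = r' -> s = s' -> (p, q, r, s) = (p', q', r', s').
Proof. by move=> -> -> -> ->. Qed.

Lemma qmulA : associative qmul.
Proof. by move=> [[[? ?] ?] ?] [[[? ?] ?] ?] [[[? ?] ?] ?]; apply: eq_quartic; ring. Qed.

Lemma qmulC : commutative qmul.
Proof. by move=> [[[? ?] ?] ?] [[[? ?] ?] ?]; apply: eq_quartic; ring. Qed.

(* [qmul x (conj x) = N + N' √2] where [conj] maps [w] to [- w]. *)
Definition qnorm (x : quartic) : int * int :=
  let: (p, q, r, s) := x in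
  let c := r * r + 2 * s * s in let d := 2 * r * s in
  (p * p + 2 * q * q + (c + 2 * d), 2 * p * q + (c + d)).

Definition qpow (n : nat) (x : quartic) : quartic := iter n (qmul x) (1, 0, 0, 0).

Definition eps : quartic := (- 1, 1, 2, - 1).

Definition eps4 : quartic := (113, - 80, - 176, 124).

(* The positive powers of [eps4] are of this shape for some [t], with [x0], [z0], [z1]
   odd; squaring doubles [t], as in Skolem's 2-adic argument. *)
Definition skolem_shape (t x0 x1 z0 z1 : int) : quartic :=
  (1 + 16 * t * t * x0, 16 * t * t * x1, 16 * t * z1, 4 * t * z0).

Lemma qnormM_one x y : qnorm x = (1, 0) -> qnorm y = (1, 0) -> qnorm (qmul x y) = (1, 0).
Proof.
case: x => [[[p q] r] s]; case: y => [[[p' q'] r'] s'] [h1 h2] [h3 h4].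
congr pair.
  transitivity ((p * p + 2 * q * q + (r * r + 2 * s * s + 2 * (2 * r * s))) * (p' * p' + 2 * q' * q' + (r' * r' + 2 * s' * s' + 2 * (2 * r' * s')))
     + 2 * (2 * p * q + (r * r + 2 * s * s + 2 * r * s)) * (2 * p' * q' + (r' * r' + 2 * s' * s' + 2 * r' * s'))); first by ring.
  by rewrite h1 h2 h3; ring.
transitivity ((p * p + 2 * q * q + (r * r + 2 * s * s + 2 * (2 * r * s))) * (2 * p' * q' + (r' * r' + 2 * s' * s' + 2 * r' * s'))
     + (2 * p * q + (r * r + 2 * s * s + 2 * r * s)) * (p' * p' + 2 * q' * q' + (r' * r' + 2 * s' * s' + 2 * (2 * r' * s')))); first by ring.
by rewrite h1 h2 h3 h4; ring.
Qed.

Lemma qpow_norm n x : qnorm x = (1, 0) -> qnorm (qpow n x) = (1, 0).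
Proof. by move=> h; elim: n => [//|n IH]; rewrite /qpow iterS; apply: qnormM_one. Qed.

Lemma qmul1 x : qmul (1, 0, 0, 0) x = x.
Proof. by case: x => [[[? ?] ?] ?]; apply: eq_quartic; ring. Qed.

Lemma qpowD m n x : qpow (m + n) x = qmul (qpow m x) (qpow n x).
Proof.
elim: m => [|m IH]; first by rewrite qmul1.
by rewrite addSn {1}/qpow iterS -/(qpow _ _) IH qmulA.
Qed.

Definition oddz (x : int) : Prop := exists i, x = 2 * i + 1.

Lemma oddzD2 x c : oddz x -> oddz (x + 2 * c).
Proof. by move=> [i ->]; exists (i + c); ring. Qed.

(** An element [X + Z w] of relative norm 1 has square [(2 X ^ 2 - 1) + 2 X Z w]; with
    [X = 1 + 16 t ^ 2 (..)] this doubles [t] and keeps the parities. *)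
Lemma skolem_shape_sqr t x0 x1 z0 z1 :
  qnorm (skolem_shape t x0 x1 z0 z1) = (1, 0) ->
  exists c0 c1 d0 d1,
  qmul (skolem_shape t x0 x1 z0 z1) (skolem_shape t x0 x1 z0 z1) =
  skolem_shape (2 * t) (x0 + 2 * c0) c1 (z0 + 2 * d0) (z1 + 2 * d1).
Proof.
move=> [h1 h2].
exists (4 * (t * t * (x0 * x0 + 2 * x1 * x1))), (x1 + 16 * t * t * x0 * x1),
  (8 * (t * t * (x0 * z0 + 4 * x1 * z1))), (t * t * (8 * x0 * z1 + 4 * x1 * z0)).
by apply: eq_quartic; [move: h1|move: h2|ring|ring]; clear; lia.
Qed.

Lemma qnorm_eps4 n : qnorm (qpow n eps4) = (1, 0).
Proof. exact: qpow_norm. Qed.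

Lemma qpow_eps4_weak n : exists x0 x1 z0 z1, qpow n eps4 = skolem_shape 1 x0 x1 z0 z1.
Proof.
elim: n => [|n [x0 [x1 [z0 [z1 E]]]]]; first by exists 0, 0, 0, 0.
rewrite /qpow iterS -/(qpow _ _) E.
exists (7 + 113 * x0 - 160 * x1 - 72 * z1 + 26 * z0), (- 5 + 113 * x1 - 80 * x0 + 52 * z1 - 18 * z0),
  (31 + 113 * z0 - 320 * z1 + 496 * x0 - 704 * x1), (- 11 + 113 * z1 - 40 * z0 - 176 * x0 + 248 * x1).
by apply: eq_quartic; ring.
Qed.

(** An even exponent is halved. For an odd one, the remaining power is a square, whose contribution
    is even, so the parities are those of [eps4] itself, namely of [7], [31] and [- 11]. *)
Lemma qpow_eps4 n : (0 < n)%N -> exists t x0 x1 z0 z1,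
  [/\ t != 0, oddz x0, oddz z0, oddz z1 & qpow n eps4 = skolem_shape t x0 x1 z0 z1].
Proof.
have [N] := ubnP n; elim: N n => // N IH n nN n0.
have sqr l : qpow (l + l) eps4 = qmul (qpow l eps4) (qpow l eps4) by rewrite qpowD.
have [n_odd|n_even] := boolP (odd n).
  have -> : n = (1 + (n./2 + n./2))%N by rewrite addnn -[LHS]odd_double_half n_odd.
  rewrite qpowD sqr.
  have := qnorm_eps4 n./2; have [x0 [x1 [z0 [z1 ->]]]] := qpow_eps4_weak n./2.
  move=> /skolem_shape_sqr[c0 [c1 [d0 [d1 ->]]]].
  move: (x0 + _) (z0 + _) (z1 + _) => y0 w0 w1.
  exists 1, (7 + 2 * (226 * y0 - 320 * c1 - 72 * w1 + 26 * w0)), (- 5 + 452 * c1 - 320 * y0 + 104 * w1 - 36 * w0),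
    (31 + 2 * (113 * w0 - 320 * w1 - 1408 * c1 + 992 * y0)), (- 11 + 2 * (113 * w1 - 40 * w0 - 352 * y0 + 496 * c1)).
  split=> //; try apply: oddzD2.
  - by exists 3.
  - by exists 15.
  - by exists (- 6).
  - by apply: eq_quartic; ring.
have [m nE] : exists m, n = (m + m)%N.
  by exists n./2; rewrite addnn -[LHS]odd_double_half (negbTE n_even).
have [||t [x0 [x1 [z0 [z1 [t0 ox oz0 oz1 E]]]]]] := IH m; [lia|lia|].
have := qnorm_eps4 m; rewrite nE sqr E => /skolem_shape_sqr[c0 [c1 [d0 [d1 ->]]]].
exists (2 * t), (x0 + 2 * c0), c1, (z0 + 2 * d0), (z1 + 2 * d1).
by split; [lia|exact: oddzD2|exact: oddzD2|exact: oddzD2|].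
Qed.

(* The norm is [1 + 32 t u] with [u] odd, hence neither [1] nor [- 1]. *)
Lemma skolem_norm t x0 x1 z0 z1 : t != 0 -> oddz x0 -> oddz z0 -> oddz z1 ->
  let e0 := 1 + 16 * t * t * x0 + 16 * t * z1 in
  let e1 := 16 * t * t * x1 + 4 * t * z0 in
  `|e0 * e0 - 2 * e1 * e1| != 1.
Proof.
move=> t0 [i ->] [j ->] [k ->] /=.
set e := (_ - _).
have [l ->] : exists l, e = 1 + 32 * (t * (2 * l + 1)).
  exists (k + t * (i - 2 * j * j - 2 * j) + 4 * t * ((t * (2 * i + 1) + 2 * k + 1) * (t * (2 * i + 1) + 2 * k + 1) - x1 * (2 * j + 1) * t - 2 * t * t * x1 * x1)).
  rewrite /e; ring.
have : t * (2 * l + 1) != 0 by rewrite mulf_neq0 //; lia.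
by move: (_ * _) => z; lia.
Qed.

(** Where [√2] is positive, the relative norm is a sum of two nonnegative terms with total
    [2 + rho = (1 + rho) rho]. *)
Lemma conj_norm_bound (R : rcfType) (rho : R) (p q r s : int) : 0 < rho -> rho * rho = 2 ->
  qnorm (p, q, r, s) = (2, 1) -> (r%:~R + s%:~R * rho) * (r%:~R + s%:~R * rho) <= rho.
Proof.
move=> rho0 rho2 [h1 h2].
have H1 := congr1 (fun x => x%:~R : R) h1; have H2 := congr1 (fun x => x%:~R : R) h2.
have b0 := sqr_ge0 (p%:~R + q%:~R * rho); rewrite expr2 in b0.
rewrite -(ler_pM2l (_ : 0 < 1 + rho)); last by lra.
have E : (p%:~R + q%:~R * rho) * (p%:~R + q%:~R * rho) + (1 + rho) * ((r%:~R + s%:~R * rho) * (r%:~R + s%:~R * rho)) = (1 + rho) * rho.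
  transitivity ((p * p + 2 * q * q + (r * r + 2 * s * s + 2 * (2 * r * s)))%:~R + (2 * p * q + (r * r + 2 * s * s + 2 * r * s))%:~R * rho).
    ring: rho2.
  rewrite H1 H2; ring: rho2.
by rewrite -E lerDr.
Qed.

(* Multiplying by [eps], with one choice of the sign of [w], decreases the coefficient
   of [w] at the place where it is not already bounded by [conj_norm_bound]. *)
Lemma descent_step (p q r s : int) : qnorm (p, q, r, s) = (2, 1) ->
  let N (x y : int) := x * x + 2 * (y * y) in
  3 <= N r s ->
  N (2 * s - r + (2 * p - 2 * q)) (r - s + (2 * q - p)) < N r s \/
  N (2 * s - r - (2 * p - 2 * q)) (r - s - (2 * q - p)) < N r s.
Proof.
move=> h N M3; have [|h1] := ltP (N (2 * s - r + _) _) (N r s); first by left.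
have [|h2] := ltP (N (2 * s - r - _) _) (N r s); first by right.
exfalso.
pose rho : realalg := Num.sqrt 2.
have rho0 : 0 < rho by rewrite sqrtr_gt0.
have rho2 : rho * rho = 2 by rewrite -expr2 sqr_sqrtr.
have rho_lt : rho < 17 / 12 by nra.
clearbody rho.
pose nrm (x y : int) : realalg := (x%:~R + y%:~R * rho) * (x%:~R + y%:~R * rho).
have nrmE x y : nrm x y + nrm x (- y) = 2 * (N x y)%:~R.
  by rewrite /nrm /N; ring: rho2.
have nrm0 x y : 0 <= nrm x y by rewrite /nrm -expr2 sqr_ge0.
have n1 : nrm r s <= rho := conj_norm_bound rho0 rho2 h.
have n2 : nrm (2 * s - r + (2 * p - 2 * q)) (r - s + (2 * q - p)) <= rho.
  apply: (@conj_norm_bound _ _ (2 * q - p - 2 * s) (p - q - r)) => //.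
  case: h => h3 h4; congr pair; [rewrite -[RHS]h3|rewrite -[RHS]h4]; ring.
have n3 : nrm (2 * s - r - (2 * p - 2 * q)) (r - s - (2 * q - p)) <= rho.
  apply: (@conj_norm_bound _ _ (2 * q - p + 2 * s) (p - q + r)) => //.
  case: h => h3 h4; congr pair; [rewrite -[RHS]h3|rewrite -[RHS]h4]; ring.
have e1 := nrmE r s.
have e2 := nrmE (2 * s - r + (2 * p - 2 * q)) (r - s + (2 * q - p)).
have e3 := nrmE (2 * s - r - (2 * p - 2 * q)) (r - s - (2 * q - p)).
have h1' : (N r s)%:~R <= (N (2 * s - r + (2 * p - 2 * q)) (r - s + (2 * q - p)))%:~R :> realalg by rewrite ler_int.
have h2' : (N r s)%:~R <= (N (2 * s - r - (2 * p - 2 * q)) (r - s - (2 * q - p)))%:~R :> realalg by rewrite ler_int.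
have M3' : 3 <= (N r s)%:~R :> realalg by rewrite (ler_int _ 3).
(* Where [√2] becomes [- rho], the two candidate coefficients have product
   [nrm r (- s) - (4 + 2 * rho)]. If neither decreased [N], this product would be at least
   [2 N - rho] in absolute value, which is impossible once [N > 1 + rho]; hence the threshold 3. *)
have prod : nrm (2 * s - r + (2 * p - 2 * q)) (- (r - s + (2 * q - p))) *
    nrm (2 * s - r - (2 * p - 2 * q)) (- (r - s - (2 * q - p))) =
    (nrm r (- s) - (4 + 2 * rho)) * (nrm r (- s) - (4 + 2 * rho)).
  have [H1 H2] := h.
  have {}H1 := congr1 (fun x => x%:~R : realalg) H1; have {}H2 := congr1 (fun x => x%:~R : realalg) H2.
  have pr : ((2 * s - r + (2 * p - 2 * q))%:~R - (r - s + (2 * q - p))%:~R * rho) *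
    ((2 * s - r - (2 * p - 2 * q))%:~R - (r - s - (2 * q - p))%:~R * rho) = nrm r (- s) - (4 + 2 * rho).
    transitivity (nrm r (- s) - (6 + 4 * rho) * ((p * p + 2 * q * q + (r * r + 2 * s * s + 2 * (2 * r * s)))%:~R
       - (2 * p * q + (r * r + 2 * s * s + 2 * r * s))%:~R * rho)).
      rewrite /nrm; ring: rho2.
    rewrite H1 H2; ring: rho2.
  by rewrite -pr /nrm; ring.
have g2 := nrm0 (2 * s - r + (2 * p - 2 * q)) (- (r - s + (2 * q - p))).
have g3 := nrm0 (2 * s - r - (2 * p - 2 * q)) (- (r - s - (2 * q - p))).
have g1 := nrm0 r s.
move: n1 n2 n3 e1 e2 e3 h1' h2' M3' prod g1 g2 g3 rho_lt rho0.
set x2 := 2 * s - r + (2 * p - 2 * q); set y2 := r - s + (2 * q - p).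
set x3 := 2 * s - r - (2 * p - 2 * q); set y3 := r - s - (2 * q - p).
move: (nrm x2 y2) (nrm x2 (- y2)) (nrm x3 y3) (nrm x3 (- y3)) => b1 b2 c1 c2.
move: (nrm r s) (nrm r (- s)) => a1 a2.
move: ((N r s)%:~R : realalg) ((N x2 y2)%:~R : realalg) ((N x3 y3)%:~R : realalg) => M M1 M2.
clear => k1 k2 k3 e1 e2 e3 l1 l2 M3 prod a0 b0 c0 r1 r0.
have hb : 2 * M - rho <= b2 by lra.
have hc : 2 * M - rho <= c2 by lra.
have M0 : 0 <= 2 * M - rho by lra.
have := ler_pM M0 M0 hb hc; rewrite prod.
have : 0 < (2 * M - rho - (a2 - (4 + 2 * rho))) * (2 * M - rho + (a2 - (4 + 2 * rho))) by apply: mulr_gt0; lra.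
by lra.
Qed.

Definition epsV : quartic := (- 1, 1, - 2, 1).

(* [eps ^ (n - 1) (1 + w)] *)
Definition qsol (n : nat) : quartic := qmul (qpow n eps) (- 1, 2, - 3, 2).

Definition qtwist (d e : int) (x : quartic) : quartic :=
  let: (p, q, r, s) := x in (d * p, d * q, e * r, e * s).

Lemma qmul_epsV x : qmul epsV (qmul eps x) = x.
Proof. by rewrite qmulA (_ : qmul epsV eps = (1, 0, 0, 0)) // qmul1. Qed.

Lemma qsolS n : qsol n.+1 = qmul eps (qsol n).
Proof. by rewrite /qsol /qpow iterS -qmulA. Qed.

Definition qsol_class (x : quartic) : Prop :=
  exists n d e, [/\ d = 1 \/ d = - 1, e = 1 \/ e = - 1 & x = qtwist d e (qsol n)].

(** Nonnegative exponents suffice because [eps (1 + w) = - (1 - w)]: negative powers are conjugates,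
    up to sign, of positive ones. *)
Lemma qsol_class_epsV x : qsol_class x -> qsol_class (qmul epsV x).
Proof.
move=> [n [d [e [hd he ->]]]].
have [ed|ed] : e = d \/ e = - d by case: hd he => -> [] ->; [left|right|right|left].
  have -> : qmul epsV (qtwist d e (qsol n)) = qtwist d d (qmul epsV (qsol n)).
    by rewrite ed; case: (qsol n) => [[[p q] r] s]; apply: eq_quartic; ring.
  case: n => [|n]; last by rewrite qsolS qmul_epsV; exists n, d, d.
  exists 4%N, (- d), d; split=> //; first by case: hd => ->; [right|left].
  by rewrite (_ : qmul epsV (qsol 0) = qtwist (- 1) 1 (qsol 4)) //; case: hd => ->.
exists n.+1, d, e; split=> //.
by rewrite qsolS ed; case: (qsol n) => [[[p q] r] s]; apply: eq_quartic; ring.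
Qed.

Lemma qnorm_step (e p q r s : int) : e = 1 \/ e = - 1 -> qnorm (p, q, r, s) = (2, 1) ->
  qnorm (qmul eps (qtwist e 1 (p, q, r, s))) = (2, 1).
Proof.
by move=> [] -> [h1 h2]; congr pair; [apply: etrans h1|apply: etrans h2|apply: etrans h1|apply: etrans h2]; ring.
Qed.

Lemma qnorm_class (p q r s : int) : qnorm (p, q, r, s) = (2, 1) -> qsol_class (p, q, r, s).
Proof.
have [K] := ubnP (absz (r * r + 2 * (s * s))); elim: K p q r s => // K IH p q r s lt_K h.
have N0 (x y : int) : 0 <= x * x + 2 * (y * y) by nia.
have step e : e = 1 \/ e = - 1 ->
    (let: (_, _, x, y) := qmul eps (qtwist e 1 (p, q, r, s)) in
     x * x + 2 * (y * y) < r * r + 2 * (s * s)) -> qsol_class (p, q, r, s).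
  move=> he; have := qnorm_step he h; have E := qmul_epsV (qtwist e 1 (p, q, r, s)).
  case: (qmul eps _) E => [[[p' q'] r'] s'] E h' l.
  have lt' : (absz (r' * r' + 2 * (s' * s'))%R < K)%N.
    by have := N0 r' s'; move: l lt_K; clear; lia.
  have := qsol_class_epsV (IH p' q' r' s' lt' h').
  rewrite E => -[m [d' [f' [hd' hf' Em]]]].
  exists m, (e * d'), f'; split=> //; first by case: he hd' => -> [] ->; [left|right|right|left].
  have -> : (p, q, r, s) = qtwist e 1 (qtwist e 1 (p, q, r, s)).
    by case: he => ->; apply: eq_quartic; ring.
  by rewrite Em; case: (qsol m) => [[[x y] z] w]; apply: eq_quartic; ring.
have [M3|M2] := lerP 3 (r * r + 2 * (s * s)).
  have [l|l] := descent_step h M3.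
    apply: (step 1); first by left.
    by apply: le_lt_trans l; rewrite le_eqVlt; apply/orP; left; apply/eqP; ring.
  apply: (step (- 1)); first by right.
  by apply: le_lt_trans l; rewrite le_eqVlt; apply/orP; left; apply/eqP; ring.
have [h1 h2] := h.
have rs : 0 <= r * r /\ 0 <= s * s by rewrite -!expr2 !sqr_ge0.
have pq : 0 <= p * p /\ 0 <= q * q by rewrite -!expr2 !sqr_ge0.
have s0 : s = 0 by nia.
rewrite s0 in M2 h1 h2; move: M2 h1 h2 pq rs; rewrite {}s0; clear => M2 h1 h2 pq rs.
have r1 : r = 1 \/ r = - 1 by nia.
have r2 : r * r = 1 by case: r1 => ->.
have q0 : q = 0 by nia.
have p1 : p = 1 \/ p = - 1 by nia.
exists 1%N, p, r; split=> //.
rewrite q0 (_ : qsol 1 = (1, 0, 1, 0)) //; apply: eq_quartic; ring.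
Qed.

Lemma qpow_mul4 n : qpow (4 * n) eps = qpow n eps4.
Proof.
elim: n => [//|n IH]; have -> : (4 * n.+1 = 4 + 4 * n)%N by lia.
by rewrite qpowD IH (_ : qpow 4 eps = eps4).
Qed.

Lemma oddzN x : oddz x -> oddz (- x).
Proof. by move=> [i ->]; exists (- i - 1); ring. Qed.

Lemma qsol_unit n :
  (let: (_, _, r, s) := qsol n in `|r * r - 2 * s * s| = 1) -> (n < 4)%N.
Proof.
have nE : n = (n %% 4 + 4 * (n %/ 4))%N by rewrite addnC mulnC -divn_eq.
have i4 : (n %% 4 < 4)%N by rewrite ltn_mod.
have [k0|k0] := posnP (n %/ 4); first by lia.
have -> : qsol n = qmul (qsol (n %% 4)) (qpow (n %/ 4) eps4).
  by rewrite [in LHS]nE /qsol qpowD qpow_mul4 -!qmulA (qmulC (_, _, _, _)).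
have [t [x0 [x1 [z0 [z1 [t0 ox oz0 oz1 ->]]]]]] := qpow_eps4 k0.
(* For the residues 0 and 3, extracting the unit [- 3 + 2 √2] from the coefficient of [w] multiplies
   the [w]-part of the power of [eps4] by [5 + 4 √2] up to sign, which preserves the two
   parities. *)
have oz0' : oddz (5 * z0 + 16 * z1) by have [j ->] := oz0; exists (5 * j + 2 + 8 * z1); ring.
have oz1' : oddz (5 * z1 + 2 * z0) by have [j ->] := oz1; exists (5 * j + 2 + z0); ring.
case: (n %% 4)%N i4 => [|[|[|[|//]]]] _.
- have /eqP H := skolem_norm x1 t0 ox (oddzN oz0') (oddzN oz1').
  rewrite (_ : qsol 0 = (- 1, 2, - 3, 2)) // => hN; case: H; apply: etrans hN; congr `|_|; ring.
- have /eqP H := skolem_norm x1 t0 ox oz0 oz1.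
  rewrite (_ : qsol 1 = (1, 0, 1, 0)) // => hN; case: H; apply: etrans hN; congr `|_|; ring.
- have /eqP H := skolem_norm x1 t0 ox (oddzN oz0) (oddzN oz1).
  rewrite (_ : qsol 2 = (- 1, 0, 1, 0)) // => hN; case: H; apply: etrans hN; congr `|_|; ring.
- have /eqP H := skolem_norm x1 t0 ox oz0' oz1'.
  rewrite (_ : qsol 3 = (1, - 2, - 3, 2)) // => hN; case: H; apply: etrans hN; congr `|_|; ring.
Qed.

Lemma unit_solutions (p q r s : int) : qnorm (p, q, r, s) = (2, 1) -> `|r * r - 2 * s * s| = 1 ->
  [\/ (p, q) = (1, 0), (p, q) = (- 1, 0), (p, q) = (1, - 2) | (p, q) = (- 1, 2)].
Proof.
move=> /qnorm_class[n [d [e [hd he E]]]] rs.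
have n4 : (n < 4)%N.
  apply: qsol_unit; case: (qsol n) E rs => [[[p' q'] r'] s'] [_ _ -> ->] h.
  by apply: etrans h; congr `|_|; case: he => ->; ring.
case: n n4 E => [|[|[|[|//]]]] _; case: hd => -> [-> -> _ _].
- by constructor 4.
- by constructor 3.
- by constructor 1.
- by constructor 2.
- by constructor 2.
- by constructor 1.
- by constructor 3.
- by constructor 4.
Qed.

(** * The equation for b in integers *)

(** Says [a + b √2 = d (1 + √2) (r + s √2) ^ 2]. Multiplication by [3 - 2 √2] or [3 + 2 √2], the
    squares of units, decreases [|b|]. *)
Lemma unit_decomposition (a b : int) : a * a - 2 * (b * b) = - 1 ->
  exists d r s : int, [/\ d = 1 \/ d = - 1, `|r * r - 2 * s * s| = 1,
    a = d * (r * r + 2 * s * s + 4 * r * s) & b = d * (r * r + 2 * s * s + 2 * r * s)].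
Proof.
have [N] := ubnP (absz b); elim: N a b => // N IH a b bN h.
have a0 : a != 0 by apply/eqP => a0; move: h; rewrite a0; nia.
have b0 : b != 0 by apply/eqP => b0; move: h; rewrite b0; nia.
have [b1|b1] := eqVneq `|b| 1.
  have {b1} [b1|b1] : b = 1 \/ b = - 1 by lia.
    have [a1|a1] : a = 1 \/ a = - 1 by nia.
      by exists 1, 1, 0; rewrite a1 b1; split=> //; left.
    by exists 1, (- 1), 1; rewrite a1 b1; split=> //; left.
  have [a1|a1] : a = 1 \/ a = - 1 by nia.
    by exists (- 1), (- 1), 1; rewrite a1 b1; split=> //; right.
  by exists (- 1), 1, 0; rewrite a1 b1; split=> //; right.
have b2 : 2 <= `|b| by lia.
have ba : `|b| < `|a| by nia.
have ab : 2 * `|a| < 3 * `|b| by nia.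
have [ab0|ab0] : 0 < a * b \/ a * b < 0 by nia.
  have [||d [r [s [hd rs aE bE]]]] := IH (3 * a - 4 * b) (3 * b - 2 * a).
  - by nia.
  - by apply: etrans h; ring.
  exists d, (r + 2 * s), (r + s); split=> //.
  - by apply: etrans rs; rewrite -normrN; congr `|_|; ring.
  - by move: aE bE; case: hd => ->; lia.
  - by move: aE bE; case: hd => ->; lia.
have [||d [r [s [hd rs aE bE]]]] := IH (3 * a + 4 * b) (3 * b + 2 * a).
- by nia.
- by apply: etrans h; ring.
exists d, (2 * s - r), (r - s); split=> //.
- by apply: etrans rs; rewrite -normrN; congr `|_|; ring.
- by move: aE bE; case: hd => ->; lia.
- by move: aE bE; case: hd => ->; lia.
Qed.

Definition zsqrt2_sol : seq (int * int) :=
  [:: (1, 1); (1, 0); (- 1, 2); (5, 3); (0, 1); (2, 1); (2, 0); (2, 2); (- 182, 130); (442, 312)].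

Lemma odd_case (i q : int) (p := 2 * i + 1) (a := 2 - p * p - 2 * (q * q)) (b := 1 - 2 * (p * q)) :
  a * a - 2 * (b * b) = - 1 -> (p, q) \in zsqrt2_sol \/ (- p, - q) \in zsqrt2_sol.
Proof.
move=> /unit_decomposition[d [r [s [[]-> rs aE bE]]]].
  have [||||] := @unit_solutions p q r s _ rs.
  - by congr pair; move: aE bE; rewrite /a /b; lia.
  - by move=> ->; left.
  - by case=> -> ->; right.
  - by case=> -> ->; right.
  - by case=> -> ->; left.
(* With the sign [- 1], conjugating [√2] and multiplying by [(1 + √2) ^ 2] restores the norm
   equation; [p + q √2] becomes [(1 + √2) (p - q √2)]. *)
have [|||||] := @unit_solutions (p - 2 * q) (p - q) r (- s).
- by congr pair; move: aE bE; rewrite /a /b; lia.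
- by apply: etrans rs; congr `|_|; ring.
- move=> [e1 e2]; have -> : p = - 1 by lia.
  have -> : q = - 1 by lia.
  by right.
- move=> [e1 e2]; have -> : p = 1 by lia.
  have -> : q = 1 by lia.
  by left.
- move=> [e1 e2]; have -> : p = - 5 by lia.
  have -> : q = - 3 by lia.
  by right.
- move=> [e1 e2]; have -> : p = 5 by lia.
  have -> : q = 3 by lia.
  by left.
Qed.

Lemma sum_sqr_eq1 (x y : int) : x * x + y * y = 1 ->
  [\/ x = 1 /\ y = 0, x = - 1 /\ y = 0, x = 0 /\ y = 1 | x = 0 /\ y = - 1].
Proof.
move=> h; have := sqr_ge0 x; have := sqr_ge0 y; rewrite !expr2 => y0 x0.
have [x1 x2] : x <= 1 /\ - 1 <= x by nia.
have [y1 y2] : y <= 1 /\ - 1 <= y by nia.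
have [xx|[xx|xx]] : x = 1 \/ x = - 1 \/ x = 0 by lia.
- by constructor 1; split=> //; move: h; rewrite xx; nia.
- by constructor 2; split=> //; move: h; rewrite xx; nia.
have [yy|yy] : y = 1 \/ y = - 1 by move: h; rewrite xx; nia.
- by constructor 3.
- by constructor 4.
Qed.

Definition circle_test (x y : int) : bool :=
  (x * x + y * y == 13 * 13) && (`|2 * (y * y) - (x + y) * (x + y)| == 1) ==>
  ((x + y, y) \in ([:: (17, 12); (- 17, - 12); (- 7, 5); (7, - 5)] : seq (int * int))).

Lemma circle_check :
  all (fun i : nat => all (fun j : nat => circle_test (i%:Z - 13) (j%:Z - 13))
    (iota 0 27)) (iota 0 27).
Proof. by vm_compute. Qed.

Lemma circle_points (x y : int) : (x - y) * (x - y) + y * y = 13 * 13 ->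
  `|2 * (y * y) - x * x| = 1 ->
  (x, y) \in ([:: (17, 12); (- 17, - 12); (- 7, 5); (7, - 5)] : seq (int * int)).
Proof.
move=> h1 h2; have [k1 [k2 [k3 k4]]] : - 13 <= x - y /\ x - y <= 13 /\ - 13 <= y /\ y <= 13 by nia.
have [i iE] : exists i : nat, x - y = i%:Z - 13 by exists (absz (x - y + 13)); lia.
have [j jE] : exists j : nat, y = j%:Z - 13 by exists (absz (y + 13)); lia.
have hi : i \in iota 0 27 by rewrite mem_iota; lia.
have hj : j \in iota 0 27 by rewrite mem_iota; lia.
have := allP (allP circle_check _ hi) _ hj; rewrite -iE -jE /circle_test.
by rewrite subrK h1 h2 !eqxx.
Qed.

(* The case [- 1] of the norm [x ^ 2 - 2 y ^ 2] leads
   to [w ^ 4 + 1 = 2 y ^ 2], the case [1] to Ljunggren's [t ^ 2 + 1 = 2 g ^ 4]. *)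
Lemma even_case (m q : int) (p := 2 * m) (a := 1 - 2 * (m * m) - q * q) (b := 1 - 4 * (m * q)) :
  (m, q) != (0, 0) -> `|2 * (a * a) - b * b| = 1 ->
  (p, q) \in zsqrt2_sol \/ (- p, - q) \in zsqrt2_sol.
Proof.
move=> nz hab.
(* [x + y √2] is [(beta ^ 2 - (p + q √2) ^ 2) / beta ^ 2]. [id2] takes norms in
   [(p + q √2) ^ 2 = (2 + √2) (1 - x - y √2)], the norm of [p + q √2] being [- 2 w]. *)
pose x := 1 - 4 * (m * m) - 2 * (q * q) + 4 * (m * q).
pose y := 2 * (m * m) + q * q - 4 * (m * q).
pose w := q * q - 2 * (m * m).
have id1 : x * x - 2 * (y * y) = 2 * (a * a) - b * b by rewrite /x /y /a /b; ring.
have id2 : 1 - 2 * x + (x * x - 2 * (y * y)) = 2 * (w * w) by rewrite /x /y /w; ring.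
have [n1|n1] : x * x - 2 * (y * y) = - 1 \/ x * x - 2 * (y * y) = 1 by lia.
  have xw : x = - (w * w) by lia.
  have ww : w * w = 1.
    by apply: (@quartic_sum_one w y); move: n1; rewrite xw; lia.
  have pq : (q - m) * (q - m) + m * m = 1 by move: xw; rewrite ww /x; lia.
  by case: (sum_sqr_eq1 pq) => -[h1 h2]; [left|right|left|right]; rewrite /p; move: h1 h2; clear;
    move=> h1 h2; have -> : q = m + (q - m) by [ring]; rewrite h1 h2.
have xw : x = 1 - w * w by lia.
have E1 : w * w * (w * w - 2) = 2 * (y * y) by move: n1; rewrite xw; lia.
have w_even : exists v, w = 2 * v.
  by have [v [wv|wv]] := parityz w; [exists v|move: E1; rewrite wv; lia].
have [k qk] : exists k, q = 2 * k.
  have [v wv] := w_even.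
  by have [k [qk|qk]] := parityz q; [exists k|move: wv; rewrite /w qk; lia].
have mk0 : gcdz m k != 0.
  by apply: contraNneq nz => /eqP; rewrite gcdz_eq0 qk => /andP[/eqP-> /eqP->].
have [M [K [mE kE cMK]]] : exists M K, [/\ m = gcdz m k * M, k = gcdz m k * K & coprimez M K].
  have [/dvdzP[M mE] /dvdzP[K kE]] := (dvdz_gcdl m k, dvdz_gcdr m k).
  exists M, K; split; [by rewrite mulrC|by rewrite mulrC|].
  have [u [v uv]] := Bezoutz m k.
  apply/coprimezP; exists (u, v) => /=; apply: (mulfI mk0).
  transitivity (u * (M * gcdz m k) + v * (K * gcdz m k)); first by ring.
  by rewrite -mE -kE uv mulr1.
move: (gcdz m k) mE kE mk0 => g mE kE g0.
pose e := 2 * (K * K) - M * M; pose Y := M * M + 2 * (K * K) - 4 * (M * K).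
have wE : w = 2 * (g * g * e) by rewrite /w /e qk kE mE; ring.
have yE : y = 2 * (g * g * Y) by rewrite /y /Y qk kE mE; ring.
have gg0 : g * g != 0 by rewrite mulf_neq0.
have XE : M * M + 2 * (K * K) - 2 * (M * K) = g * g * (e * e).
  apply: (mulfI gg0); move: xw; rewrite wE /x qk kE mE; lia.
have YE : e * e * (2 * (g * g * e * (g * g * e)) - 1) = Y * Y.
  apply: (mulfI (mulf_neq0 gg0 gg0)); move: E1; rewrite wE yE; lia.
have /dvdzP[t Yt] : (e %| Y)%Z.
  rewrite dvdzE -(dvdn_pexp2r (absz e) (absz Y) (isT : (0 < 2)%N)) -!abszX -dvdzE.
  apply/dvdzP.
  by exists (2 * (g * g * e * (g * g * e)) - 1); rewrite !expr2 -YE mulrC.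
(* [e] divides both [4 K ^ 2] and [2 M ^ 2] with [M], [K] coprime, hence divides 4; being odd, it is
   [1] or [- 1], and [tE] becomes Ljunggren's equation. *)
have [c ec] : exists c, 4 = c * e.
  have [[u v] /= uv] : exists uv, uv.1 * (M * M) + uv.2 * (K * K) = 1.
    by apply/coprimezP; rewrite coprimezMl !coprimezMr cMK.
  have h1 : 4 * (K * K) = (2 * (g * g * e) - t + 1) * e by move: XE Yt; rewrite /Y /e; lia.
  have h2 : 2 * (M * M) = (2 * (g * g * e) - t - 1) * e by move: XE Yt; rewrite /Y /e; lia.
  exists (2 * u * (2 * (g * g * e) - t - 1) + v * (2 * (g * g * e) - t + 1)).
  transitivity (4 * (u * (M * M) + v * (K * K))); first by rewrite uv.
  by transitivity (2 * u * (2 * (M * M)) + v * (4 * (K * K))); [ring|rewrite h1 h2; ring].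
have e0 : e != 0 by apply/eqP => e0; move: ec; rewrite e0 mulr0.
have tE : 2 * (g * g * e * (g * g * e)) - 1 = t * t.
  by apply: (mulfI (mulf_neq0 e0 e0)); rewrite YE Yt; ring.
have e1 : e = 1 \/ e = - 1.
  have [f ef] := parityz e; have [f' tf] := parityz t.
  have [l lE] : exists l, g * g * e = l by exists (g * g * e).
  have e_odd : e = 2 * f + 1.
    case: ef => // ef; exfalso; move: tE; rewrite ef; move: (g * g) => z.
    case: tf => ->; lia.
  have : `|e| <= 4.
    have c0 : 1 <= `|c| by rewrite -gtz0_ge1 normr_gt0; apply/eqP => c0; move: ec; rewrite c0 mul0r.
    have -> : 4 = `|c| * `|e| by rewrite -normrM -ec.
    by rewrite ler_peMl.
  have : e != 3 /\ e != - 3 by split; apply/eqP => e3; move: ec; rewrite e3; lia.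
  by move: e_odd; clear; lia.
have ee : e * e = 1 by case: e1 => ->.
have g13 : `|g| = 1 \/ `|g| = 13.
  apply: (@ljunggren t); first by rewrite normr_gt0.
  have gn : `|g| * `|g| = g * g by rewrite -!expr2 real_normK ?num_real.
  rewrite gn -tE subrK; congr (2 * _).
  by transitivity (g * g * (g * g) * (e * e)); [ring|rewrite ee mulr1].
rewrite ee mulr1 in XE.
have XE' : (M - K) * (M - K) + K * K = `|g| * `|g|.
  by rewrite -expr2 -[RHS]expr2 real_normK ?num_real // [RHS]expr2 -XE; ring.
have abs_e : `|2 * (K * K) - M * M| = 1 by rewrite -/e; case: e1 => ->.
have gs : g = `|g| \/ g = - `|g| by lia.
have pE : p = 2 * g * M by rewrite /p mE mulrA.
have qE : q = 2 * g * K by rewrite qk kE mulrA.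
rewrite pE qE; clear - gs g13 XE' abs_e.
case: g13 gs XE' => -> gs XE.
  have : (M, K) \in [:: (1, 0); (- 1, 0); (1, 1); (- 1, - 1)].
    have := sum_sqr_eq1 (etrans XE (mulr1 1)).
    by case=> -[h k]; rewrite -(subrK K M) h k.
  rewrite !inE => /or4P[] /eqP[-> ->]; case: gs => ->; by [left|right].
have := circle_points XE abs_e.
rewrite !inE => /or4P[] /eqP[-> ->]; case: gs => ->; by [left|right].
Qed.

(** Odd squares are 1 modulo 8, so the norm is [- 1] modulo 8; the only such divisor of 8 is
    [- 1]. *)
Lemma dvd8_norm (a b n : int) : (a * a - 2 * (b * b)) * n = 8 ->
  (exists i, a = 2 * i + 1) -> (exists j, b = 2 * j + 1) -> a * a - 2 * (b * b) = - 1.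
Proof.
move=> h [i ai] [j bj].
have [s sE] : exists s, a * a - 2 * (b * b) = 4 * s - 1.
  by exists (i * i + i - 2 * (j * j + j)); rewrite ai bj; ring.
have [t tE] : exists t, i * i + i = 2 * t.
  have [k [ik|ik]] := parityz i; [exists (k * (2 * k + 1))|exists ((2 * k + 1) * (k + 1))]; rewrite ik; ring.
have [t' tE'] : exists t, j * j + j = 2 * t.
  have [k [ik|ik]] := parityz j; [exists (k * (2 * k + 1))|exists ((2 * k + 1) * (k + 1))]; rewrite ik; ring.
have nE : a * a - 2 * (b * b) = 8 * (t - 2 * t') - 1.
  transitivity (4 * (i * i + i) - 8 * (j * j + j) - 1); first by rewrite ai bj; ring.
  by rewrite tE tE'; ring.
move: h; rewrite nE; move: (t - _) => k h.
have : `|8 * k - 1| <= 8.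
  have n0 : n != 0 by apply/eqP => n0; move: h; rewrite n0 mulr0.
  have n1 : 1 <= `|n| by rewrite -gtz0_ge1 normr_gt0.
  by apply: le_trans (ler_peMr (normr_ge0 _) n1) _; rewrite -normrM h.
have [k1|k1] : k = 0 \/ k <> 0 by lia.
  by rewrite k1.
move=> k8; have kk : k = 1 by lia.
by move: h; rewrite kk; lia.
Qed.

(* The hypotheses say [(x + y √2) (a + b √2) = 2 (p + q √2)]; then [a + b √2] divides
   [2 (2 + √2)], with quotient [c0 + c1 √2]. *)
Lemma pcf_equations_sol (p q x y : int) (a := 2 - p * p - 2 * (q * q)) (b := 1 - 2 * (p * q)) :
  (p, q) != (0, 0) -> x * a + 2 * (y * b) = 2 * p -> x * b + y * a = 2 * q ->
  (p, q) \in zsqrt2_sol \/ (- p, - q) \in zsqrt2_sol.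
Proof.
move=> nz h1 h2.
pose c0 := 2 + p * x + 2 * (q * y); pose c1 := p * y + q * x.
have e1 : a * c0 + 2 * (b * c1) = 4.
  transitivity (2 * a + p * (x * a + 2 * (y * b)) + 2 * q * (x * b + y * a)).
    by rewrite /c0 /c1; ring.
  by rewrite h1 h2 /a; ring.
have e2 : a * c1 + b * c0 = 2.
  transitivity (2 * b + q * (x * a + 2 * (y * b)) + p * (x * b + y * a)).
    by rewrite /c0 /c1; ring.
  by rewrite h1 h2 /b; ring.
have nn : (a * a - 2 * (b * b)) * (c0 * c0 - 2 * (c1 * c1)) = 8.
  transitivity ((a * c0 + 2 * (b * c1)) * (a * c0 + 2 * (b * c1))
    - 2 * ((a * c1 + b * c0) * (a * c1 + b * c0))); first by ring.
  by rewrite e1 e2.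
have b_odd : exists j, b = 2 * j + 1 by exists (- (p * q)); rewrite /b; ring.
have [i [pi|pi]] := parityz p; last first.
  have := dvd8_norm nn _ b_odd; rewrite /a /b pi => h; apply: odd_case; apply: h.
  by exists (- 2 * (i * i + i) - q * q); ring.
have hi : (i, q) != (0, 0).
  by apply: contraNneq nz => -[i0 q0]; rewrite pi i0 q0.
rewrite pi; apply: even_case => //.
move: nn; rewrite /a /b pi; set n := c0 * c0 - _ => nn.
set a' := 1 - 2 * (i * i) - q * q; set b' := 1 - 4 * (i * q).
have {}nn : (2 * (a' * a') - b' * b') * n = 4.
  by apply: (mulfI (isT : (2 : int) != 0)); apply: etrans nn; rewrite /a' /b'; ring.
have [z zE] : exists z, 2 * (a' * a') - b' * b' = 2 * z + 1.
  by exists (a' * a' - 1 + 4 * (i * q) - 8 * (i * q * (i * q))); rewrite /b'; ring.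
rewrite zE in nn *.
have : `|2 * z + 1| <= 4.
  have n0 : n != 0 by apply/eqP => n0; move: nn; rewrite n0 mulr0.
  have n1 : 1 <= `|n| by rewrite -gtz0_ge1 normr_gt0.
  by apply: le_trans (ler_peMr (normr_ge0 _) n1) _; rewrite -normrM nn.
move=> z4; have [z1|[z1|[z1|z1]]] : z = 0 \/ z = - 1 \/ z = 1 \/ z = - 2 by lia.
- by rewrite z1.
- by rewrite z1.
- by move: nn; rewrite z1; lia.
- by move: nn; rewrite z1; lia.
Qed.

(** * Convergence of continued fractions of type (1,2) *)

Require Import Defs.
From mathcomp Require Import all_classical all_reals all_analysis finmap.
Import Order.TTheory GRing.Theory Num.Theory numFieldNormedType.Exports.

Local Open Scope classical_set_scope.
Local Open Scope ring_scope.
Local Open Scope complex_scope.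

Fixpoint cf_step (F : pzRingType) (c : nat -> F) (uv : F * F) (n : nat) : F * F :=
  if n is m.+1 then let w := cf_step c uv m in (w.1 * c m + w.2, w.1) else uv.

Definition cf_num (F : pzRingType) (c : nat -> F) n := (cf_step c (1, 0) n).1.
Definition cf_den (F : pzRingType) (c : nat -> F) n := (cf_step c (0, 1) n).1.

Definition pcf12_seq (F : pzRingType) (b a1 a2 : F) (n : nat) : F :=
  if n == 0%N then b else if odd n then a1 else a2.

Lemma convergentE (R : realType) (c : nat -> R) n :
  convergent (fun i => (c i)%:C) n = P1_of_coords (cf_num c n)%:C (cf_den c n)%:C.
Proof.
rewrite /convergent.
pose M m : 'M[R[i]]_2 := \prod_(i < m) D (c i)%:C.
suff H m : [/\ M m 0 0 = (cf_step c (1, 0) m).1%:C, M m 0 1 = (cf_step c (1, 0) m).2%:C,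
    M m 1 0 = (cf_step c (0, 1) m).1%:C & M m 1 1 = (cf_step c (0, 1) m).2%:C].
  by rewrite -/(M n); have [-> _ -> _] := H n.
elim: m => [|m [h1 h2 h3 h4]]; first by rewrite /M big_ord0 !mxE.
have MS i j : M m.+1 i j = M m i 0 * D (c m)%:C 0 j + M m i 1 * D (c m)%:C 1 j.
  rewrite /M big_ord_recr mxE !big_ord_recl big_ord0 addr0.
  by congr (_ + M m i _ * D _ _ _); apply: val_inj.
split; rewrite MS !mxE /= ?(mulr1, mulr0, addr0) ?h1 ?h2 ?h3 ?h4 // rmorphD rmorphM //=.
Qed.

(** The coefficients are the entries of [D(b) D(a1) D(a2) D(b)^-1], which moves the period to the
    left of the product and so acts directly on convergents. *)
Lemma cf_step_pcf12 (F : comPzRingType) (b a1 a2 : F) n (c := pcf12_seq b a1 a2) :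
  cf_num c n.+2 = (a1 * b + 1) * cf_num c n + ((a1 * b + 1) * (a2 - b) + b) * cf_den c n /\
  cf_den c n.+2 = a1 * cf_num c n + (a1 * (a2 - b) + 1) * cf_den c n.
Proof.
have recN m : cf_num c m.+2 = cf_num c m.+1 * c m.+1 + cf_num c m by [].
have recD m : cf_den c m.+2 = cf_den c m.+1 * c m.+1 + cf_den c m by [].
elim/ltn_ind: n => -[_|[_|n IH]].
- by rewrite /cf_num /cf_den /= /c /pcf12_seq /=; split; ring.
- by rewrite /cf_num /cf_den /= /c /pcf12_seq /=; split; ring.
have cS : c n.+3 = c n.+1 by rewrite /c /pcf12_seq /= negbK.
have [[n1 d1] [n2 d2]] := (IH n (leqnSn n.+1), IH n.+1 (leqnn n.+2)).
rewrite (recN n.+2) (recD n.+2) cS n2 d2; split.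
  by rewrite [in LHS]n1 (recN n) (recD n); ring.
by rewrite [in LHS]d1 (recN n) (recD n); ring.
Qed.

Lemma cvg_real_complex (R : realType) (x : nat -> R) (l : R) :
  (x @ \oo --> l) <-> ((fun n => (x n)%:C : R[i]^o) @ \oo --> (l%:C : R[i]^o)).
Proof.
split=> [h|h].
  apply/cvgrPdist_lt => e; rewrite ltcE /= => /andP[/eqP ei e0].
  have eE : e = (complex.Re e)%:C by case: e ei {e0} => a b /= ->.
  move/cvgrPdist_lt: h => /(_ _ e0); apply: filterS => n hn.
  by rewrite -rmorphB /= normc_def /= expr0n /= addr0 sqrtr_sqr eE ltcR.
apply/cvgrPdist_lt => e e0.
move/cvgrPdist_lt: h => /(_ e%:C); rewrite ltcR => /(_ e0); apply: filterS => n.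
by rewrite -rmorphB /= normc_def /= expr0n /= addr0 sqrtr_sqr ltcR.
Qed.

(** A neighbourhood of a finite point may be taken to avoid infinity, so convergence there forces
    the denominators to be eventually nonzero. *)
Lemma has_value_real (R : realType) (c : nat -> R) (l : R) :
  has_value (fun i => (c i)%:C) (P1_of_C l%:C) <->
  (\forall n \near \oo, cf_den c n != 0) /\ (cf_num c n / cf_den c n @[n --> \oo] --> l).
Proof.
have E : convergent (fun i => (c i)%:C) =
    (fun n => if cf_den c n == 0 then None else Some ((cf_num c n / cf_den c n)%:C)) :> (nat -> P1 R).
  apply/funext => n; rewrite convergentE /P1_of_coords fmorph_eq0.
  by case: eqP => // _; rewrite rmorphM /= fmorphV.
rewrite /has_value E; split=> [h|[h1 h2]].
  have hn U : nbhs (l%:C : R[i]^o) U ->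
      \forall n \near \oo, cf_den c n != 0 /\ U (cf_num c n / cf_den c n)%:C.
    move=> Ul.
    have hU : \forall n \near \oo, (Some @` U)
        (if cf_den c n == 0 then None else Some (cf_num c n / cf_den c n)%:C) :=
      h _ (@one_point_compactification_some_nbhs (R[i]^o) _ _ Ul).
    near=> n; have [z Uz] : (Some @` U)
        (if cf_den c n == 0 then None else Some (cf_num c n / cf_den c n)%:C).
      by near: n; exact: hU.
    by case: eqP => // _ [zE]; split=> //; rewrite -zE.
  split; first by apply: filterS (hn _ filterT) => n [].
  apply/cvg_real_complex => U /hn; apply: filterS => n [_]; exact.
move/cvg_real_complex: h2 => h2 U /= Ul.
have := h2 _ Ul; rewrite /nbhs /= => h3.
near=> n; rewrite /= ifN; last by near: n.
near: n; exact: h3.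
Unshelve. all: by end_near.
Qed.

(** [cf_num + l * cf_den] and [cf_num - l * cf_den] diagonalise the two-step matrix, with
    eigenvalues of ratio [r ^ 2]. The sign of [l] is left free so that the case [l = - beta] can
    exclude [b < 0]. *)
Lemma pcf12_cvg (R : realType) (b a1 l : R) (c := pcf12_seq b a1 (2 * b)) :
  l != 0 -> `|b - l| < `|b + l| -> a1 * (l ^+ 2 - b ^+ 2) = 2 * b ->
  (forall n, cf_den c n.+1 != 0) /\ (cf_num c n / cf_den c n @[n --> \oo] --> l).
Proof.
move=> l0 bl hb.
have bl0 : b + l != 0 by rewrite -normr_gt0; apply: le_lt_trans bl.
have lb0 : l - b != 0.
  apply: contra_neqN l0 => /eqP lb; have lb' : l = b by apply/eqP; rewrite -subr_eq0 lb.
  move: hb; rewrite lb' subrr mulr0 => hb; lra.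
pose r := (b - l) / (b + l).
have r1 : `|r| < 1 by rewrite normf_div ltr_pdivrMr ?mul1r // normr_gt0.
have rn1 n : r ^+ n.+1 != 1.
  apply/eqP => rn; have : `|r| ^+ n.+1 < 1 by rewrite exprn_ilt1.
  by rewrite -normrX rn normr1 ltxx.
have m1 : a1 * b + 1 + a1 * l = (b + l) / (l - b).
  by apply: (mulIf lb0); rewrite divfK //; move: hb => /eqP; rewrite -subr_eq0 => /eqP hb; apply/eqP; rewrite -subr_eq0 -hb; apply/eqP; ring.
have m2 : a1 * b + 1 - a1 * l = r ^+ 2 * ((b + l) / (l - b)).
  apply: (mulIf bl0); transitivity (l - b).
    by move: hb => /eqP; rewrite -subr_eq0 => /eqP hb; apply/eqP; rewrite -subr_eq0 -oppr_eq0 -hb; apply/eqP; ring.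
  by rewrite /r; field; rewrite bl0 lb0.
have key n : cf_num c n + l * cf_den c n != 0 /\
    cf_num c n - l * cf_den c n = r ^+ n * (cf_num c n + l * cf_den c n).
  elim/ltn_ind: n => -[_|[_|n IH]].
  - by rewrite /cf_num /cf_den /= mulr0 addr0 subr0 mul1r oner_neq0.
  - rewrite /cf_num /cf_den /= /c /pcf12_seq /= !(mulr1, mul1r, mul0r, add0r, addr0); split=> //.
    by rewrite expr1 /r divfK.
  have [q0 pq] := IH n (leqnSn n.+1).
  have [nE dE] := cf_step_pcf12 b a1 (2 * b) n.
  rewrite -/c in nE dE; rewrite nE dE.
  have -> : (a1 * b + 1) * (2 * b - b) + b = a1 * l ^+ 2.
    by move: hb => /eqP; rewrite -subr_eq0 => /eqP hb; apply/eqP; rewrite -subr_eq0 -oppr_eq0 -hb; apply/eqP; ring.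
  have qE : (a1 * b + 1) * cf_num c n + a1 * l ^+ 2 * cf_den c n +
      l * (a1 * cf_num c n + (a1 * (2 * b - b) + 1) * cf_den c n) =
      (b + l) / (l - b) * (cf_num c n + l * cf_den c n) by rewrite -m1; ring.
  have pE : (a1 * b + 1) * cf_num c n + a1 * l ^+ 2 * cf_den c n -
      l * (a1 * cf_num c n + (a1 * (2 * b - b) + 1) * cf_den c n) =
      r ^+ 2 * ((b + l) / (l - b)) * (cf_num c n - l * cf_den c n) by rewrite -m2; ring.
  rewrite qE pE pq; split; first by rewrite !mulf_neq0 ?invr_eq0.
  by rewrite -[n.+2]addn2 exprD; ring.
have dE n : cf_den c n = (1 - r ^+ n) * (cf_num c n + l * cf_den c n) / (2 * l).
  by have [_ h] := key n; rewrite mulrBl mul1r -h; field.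
have nE n : cf_num c n = (1 + r ^+ n) * (cf_num c n + l * cf_den c n) / 2.
  by have [_ h] := key n; rewrite mulrDl mul1r -h; field.
have d0 n : cf_den c n.+1 != 0.
  have [q0 _] := key n.+1; rewrite dE !mulf_neq0 ?invr_eq0 ?mulf_neq0 ?pnatr_eq0 //.
  by rewrite subr_eq0 eq_sym.
split=> //; rewrite -cvg_shiftS /=.
have -> : (fun n => cf_num c n.+1 / cf_den c n.+1) =
    (fun n => l * (1 + r ^+ n.+1) / (1 - r ^+ n.+1)).
  apply/funext => n; have [q0 _] := key n.+1.
  rewrite (dE n.+1) {1}(nE n.+1); move: q0 => q0; field.
  by rewrite l0 q0 subr_eq0 eq_sym rn1.
have cr : r ^+ n.+1 @[n --> \oo] --> (0 : R).
  by have := cvg_expr r1; rewrite -cvg_shiftS.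
have : (fun n => l * (1 + r ^+ n.+1) / (1 - r ^+ n.+1)) @ \oo --> l * (1 + 0) / (1 - 0).
  apply: cvgM; first by apply: cvgM; [exact: cvg_cst|apply: cvgD => //; exact: cvg_cst].
  by apply: cvgV; [rewrite subr0 oner_neq0|apply: cvgB => //; exact: cvg_cst].
by rewrite addr0 subr0 divr1 mulr1.
Qed.

(** The first part passes to the limit in the two-step recurrence; for the second, [a1 = a2 = 0]
    would make every even-indexed denominator vanish. *)
Lemma pcf12_limit (R : realType) (b a1 a2 l : R) (c := pcf12_seq b a1 a2) :
  (\forall n \near \oo, cf_den c n != 0) -> (cf_num c n / cf_den c n @[n --> \oo] --> l) ->
  l * (a1 * l + (a1 * (a2 - b) + 1)) = (a1 * b + 1) * l + ((a1 * b + 1) * (a2 - b) + b) /\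
  (a1 != 0 \/ a2 != 0).
Proof.
move=> d0 cx; set x := (fun n => _) in cx.
have cx2 : x n.+2 @[n --> \oo] --> l by move: cx; rewrite -cvg_shiftS -cvg_shiftS.
have d2 : \forall n \near \oo, cf_den c n.+2 != 0.
  by move: d0 => [N _ h]; exists N => // n /= Nn; apply: h; rewrite /= -addn2; apply: leq_trans Nn (leq_addr _ _).
split.
  apply: (@cvg_unique R _ ((fun n => x n.+2 * (a1 * x n + (a1 * (a2 - b) + 1))) @ \oo)).
  - exact: norm_hausdorff.
  - apply: cvgM => //; apply: cvgD; [exact: cvgMr|exact: cvg_cst].
  have h : (fun n => (a1 * b + 1) * x n + ((a1 * b + 1) * (a2 - b) + b)) @ \oo -->
      (a1 * b + 1) * l + ((a1 * b + 1) * (a2 - b) + b).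
    apply: cvgD; [exact: cvgMr|exact: cvg_cst].
  apply: cvg_trans h; apply: near_eq_cvg; near=> n.
  have n0 : cf_den c n != 0 by near: n.
  have n2 : cf_den c n.+2 != 0 by near: n.
  have [nE dE] := cf_step_pcf12 b a1 a2 n; rewrite -/c in nE dE.
  apply: (mulIf n0).
  have -> : x n.+2 * (a1 * x n + (a1 * (a2 - b) + 1)) * cf_den c n = cf_num c n.+2.
    have -> : x n.+2 = cf_num c n.+2 / cf_den c n.+2 by [].
    apply: (mulIf n2); rewrite dE /x; field.
    by rewrite -dE n0 n2.
  by rewrite nE /x; field.
apply/orP; rewrite -negb_and; apply/negP => /andP[/eqP a10 /eqP a20].
have z n : cf_den c n.*2 = 0.
  elim: n => // n IH; rewrite doubleS.
  by have [_] := cf_step_pcf12 b a1 a2 n.*2; rewrite -/c => ->; rewrite IH a10 mul0r mulr0 addr0.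
move: d0 => [N _ h]; have := h N.*2; rewrite /= z eqxx => H; suff : false by [].
by apply: H; rewrite /= -addnn leq_addr.
Unshelve. all: by end_near.
Qed.

(** * Arithmetic of Z[√2] and of √(2 + √2) in the reals *)

Lemma sqr_eq_double_sqr (m n : int) : m * m = 2 * (n * n) -> m = 0 /\ n = 0.
Proof.
have [N] := ubnP (absz m + absz n)%N; elim: N m n => // N IH m n mN h.
have [k [mk|mk]] := parityz m; last by move: h; rewrite mk; lia.
have h' : n * n = 2 * (k * k) by move: h; rewrite mk; lia.
have [k0|k0] := eqVneq k 0.
  by move: mk h'; rewrite k0 !mulr0 => -> /eqP; rewrite mulf_eq0 orbb => /eqP.
have [|n0 k0'] := IH n k _ h'; first by lia.
by rewrite mk k0' mulr0.
Qed.

Definition zroot2 (R : realType) (m n : int) : R := m%:~R + n%:~R * Num.sqrt 2.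

Lemma sqr_sqrt2 (R : realType) : (Num.sqrt 2 : R) * Num.sqrt 2 = 2.
Proof. by rewrite -expr2 sqr_sqrtr // ler0n. Qed.

Lemma zroot2D (R : realType) a b c d : zroot2 R a b + zroot2 R c d = zroot2 R (a + c) (b + d).
Proof. rewrite /zroot2 !intrD; ring. Qed.

Lemma zroot2N (R : realType) a b : - zroot2 R a b = zroot2 R (- a) (- b).
Proof. rewrite /zroot2 !rmorphN /=; ring. Qed.

Lemma zroot2M (R : realType) a b c d :
  zroot2 R a b * zroot2 R c d = zroot2 R (a * c + 2 * (b * d)) (a * d + b * c).
Proof.
rewrite /zroot2 !intrD !intrM.
transitivity (a%:~R * c%:~R + b%:~R * d%:~R * (Num.sqrt 2 * Num.sqrt 2) +
  (a%:~R * d%:~R + b%:~R * c%:~R) * (Num.sqrt 2 : R)); first by ring.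
by rewrite sqr_sqrt2; ring.
Qed.

Lemma zroot2_eq0 (R : realType) a b : zroot2 R a b = 0 -> a = 0 /\ b = 0.
Proof.
move=> h; apply: sqr_eq_double_sqr; apply/eqP; rewrite -subr_eq0 -(intr_eq0 R).
have := congr1 (fun x => x * zroot2 R a (- b)) h; rewrite zroot2M mul0r => <-.
by apply/eqP; rewrite /zroot2 -[a * - b + b * a]/(_) (_ : a * - b + b * a = 0); [rewrite mul0r addr0; congr _%:~R; ring|ring].
Qed.

Lemma zroot2_inj (R : realType) a b c d : zroot2 R a b = zroot2 R c d -> a = c /\ b = d.
Proof.
move/eqP; rewrite -subr_eq0 zroot2N zroot2D => /eqP /zroot2_eq0[/eqP h1 /eqP h2].
by split; apply/eqP; rewrite -subr_eq0.
Qed.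

Definition zbeta (R : realType) : R := Num.sqrt (2 + Num.sqrt 2).

Lemma sqr_zbeta (R : realType) : zbeta R * zbeta R = zroot2 R 2 1.
Proof. by rewrite -expr2 sqr_sqrtr ?addr_ge0 ?sqrtr_ge0 // /zroot2 mul1r. Qed.

Lemma zbeta_gt0 (R : realType) : 0 < zbeta R.
Proof. by rewrite sqrtr_gt0 ltr_wpDr ?sqrtr_ge0. Qed.

(** The norm of [2 + √2] is 2, so a relation would make a square equal to twice a square. *)
Lemma zbeta_independent (R : realType) a b c d :
  zroot2 R a b + zroot2 R c d * zbeta R = 0 -> zroot2 R a b = 0 /\ zroot2 R c d = 0.
Proof.
move=> h; have {}h : zroot2 R a b * zroot2 R a b = zroot2 R c d * zroot2 R c d * zroot2 R 2 1.
  move/eqP: h; rewrite addr_eq0 => /eqP ->; rewrite -sqr_zbeta; ring.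
rewrite !zroot2M in h; have [h1 h2] := zroot2_inj h.
have [n1 n2] : a * a - 2 * (b * b) = 0 /\ c * c - 2 * (d * d) = 0.
  apply: sqr_eq_double_sqr.
  transitivity ((a * a + 2 * (b * b)) * (a * a + 2 * (b * b)) -
    2 * ((a * b + b * a) * (a * b + b * a))); first by ring.
  rewrite h1 h2; ring.
have [-> ->] : a = 0 /\ b = 0 by apply: sqr_eq_double_sqr; apply/eqP; rewrite -subr_eq0 n1.
have [-> ->] : c = 0 /\ d = 0 by apply: sqr_eq_double_sqr; apply/eqP; rewrite -subr_eq0 n2.
by rewrite /zroot2 mul0r addr0.
Qed.

Lemma zroot2E (R : realType) m n : zsqrt2 R m n = (zroot2 R m n)%:C.
Proof.
rewrite /zsqrt2; have -> : sqrtC (2 : R[i]) = (Num.sqrt (2 : R))%:C.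
  have -> : (2 : R[i]) = (Num.sqrt (2 : R))%:C ^+ 2.
    by rewrite expr2 -rmorphM sqr_sqrt2 rmorph_nat.
  by rewrite sqrCK // lecR sqrtr_ge0.
by rewrite /zroot2 rmorphD rmorphM !rmorph_int.
Qed.

Lemma zbetaE (R : realType) : sqrtC (2 + sqrtC 2) = (zbeta R)%:C :> R[i].
Proof.
have -> : 2 + sqrtC 2 = zsqrt2 R 2 1 by rewrite /zsqrt2 mul1r.
by rewrite zroot2E -sqr_zbeta rmorphM -expr2 sqrCK // lecR ltW // zbeta_gt0.
Qed.

Lemma pcf12_zbeta (R : realType) (p q x y u v : int)
    (b := zroot2 R p q) (a1 := zroot2 R x y) (a2 := zroot2 R u v) (c := pcf12_seq b a1 a2) :
  has_value (fun i => (c i)%:C) (P1_of_C (zbeta R)%:C) <->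
  [/\ a2 = 2 * b, a1 * (zbeta R ^+ 2 - b ^+ 2) = 2 * b & 0 < b].
Proof.
have l_gt0 := zbeta_gt0 R; rewrite has_value_real; split=> [[d0 cx]|[a2b hb b0]]; last first.
  rewrite /c a2b; have [|||d0 cx] := @pcf12_cvg R b a1 (zbeta R).
  - by rewrite gt_eqF.
  - by rewrite ltr_normr; apply/orP; left; rewrite ltr_norml; apply/andP; split; lra.
  - by [].
  by split=> //; exists 1%N => // -[|n].
have [lim nz] := pcf12_limit d0 cx.
have [A [B AB]] : exists A B,
    a1 * zroot2 R 2 1 - (a1 * b + zroot2 R 1 0) * (a2 - b) - b = zroot2 R A B.
  by do 2 eexists; rewrite /a1 /b /a2 !(zroot2N, zroot2M, zroot2D).
have [A' [B' AB']] : exists A B, a1 * (a2 - b - b) = zroot2 R A B.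
  by do 2 eexists; rewrite /a1 /b /a2 !(zroot2N, zroot2M, zroot2D).
have z1 : zroot2 R 1 0 = 1 by rewrite /zroot2 mul0r addr0.
rewrite z1 -sqr_zbeta in AB.
have [] := @zbeta_independent R A B A' B'.
  rewrite -AB -AB'; move/eqP: lim; rewrite -subr_eq0 => /eqP lim; rewrite -[RHS]lim; ring.
rewrite -AB -AB' => e1 /eqP; rewrite mulf_eq0 => e2.
have a10 : a1 != 0.
  apply/eqP => a10; case: nz => [|/negP]; [by rewrite a10 eqxx|apply].
  by rewrite -oppr_eq0 -[X in _ == X]e1 a10; apply/eqP; ring.
have a2b : a2 = 2 * b.
  move: e2; rewrite (negbTE a10) /= -addrA -opprD subr_eq0 => /eqP ->; ring.
have hb : a1 * (zbeta R ^+ 2 - b ^+ 2) = 2 * b.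
  by apply/eqP; rewrite -subr_eq0 -[X in _ == X]e1 a2b; apply/eqP; ring.
split=> //; have [//|b0|b0] := ltgtP 0 b.
  have [|||_ cx'] := @pcf12_cvg R b a1 (- zbeta R).
  - by rewrite oppr_eq0 gt_eqF.
  - by rewrite opprK ltr_normr; apply/orP; right; rewrite ltr_norml; apply/andP; split; lra.
  - by rewrite sqrrN.
  have E : zbeta R = - zbeta R.
    rewrite /c a2b in cx.
    exact: (cvg_unique (@norm_hausdorff _ R) cx cx').
  by exfalso; lra.
move: hb; rewrite -b0 expr0n subr0 mulr0 => /eqP.
by rewrite mulf_eq0 (negbTE a10) expf_eq0 (gt_eqF l_gt0).
Qed.

(* The four large quotients are parameters, so that their unary literals are
   never unfolded. *)
Definition pcf12_table (A B A' B' : int) : seq ((int * int) * (int * int) * (int * int)) :=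
  [:: ((1, 1), (-2, 0), (2, 2));
    ((1, 0), (-2, 2), (2, 0));
    ((-1, 2), (26, 18), (-2, 4));
    ((5, 3), (62, -44), (10, 6));
    ((0, 1), (2, 0), (0, 2));
    ((2, 1), (2, -2), (4, 2));
    ((2, 0), (-4, -2), (4, 0));
    ((2, 2), (8, -6), (4, 4));
    ((-182, 130), (A, B), (-364, 260));
    ((442, 312), (A', B'), (884, 624))].

(** The last clause is an integer certificate of [p + q √2 > 0], as [41 / 29] is a convergent of
    [√2] from below. The previous lower convergent [7 / 5] would only give 0 for
    [- 182 + 130 √2]. *)
Definition pcf12_eqs (t : (int * int) * (int * int) * (int * int)) : Prop :=
  let: (p, q, (x, y), (u, v)) := t in
  [/\ u = 2 * p /\ v = 2 * q,
    x * (2 - p * p - 2 * (q * q)) + 2 * (y * (1 - 2 * (p * q))) = 2 * p,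
    x * (1 - 2 * (p * q)) + y * (2 - p * p - 2 * (q * q)) = 2 * q
    & 0 < 29 * p + 41 * q /\ 0 <= q].

Lemma pcf12_table_eqs A B A' B' t : A = - (104 * 1189) -> B = - (78 * 1121) ->
  A' = - (52 * (28 * 205 + 1)) -> B' = 46 * 4589 -> t \in pcf12_table A B A' B' -> pcf12_eqs t.
Proof.
move=> hA hB hA' hB'; rewrite !inE.
case/or4P=> [/eqP->|/eqP->|/eqP->|]; last first.
  case/or4P=> [/eqP->|/eqP->|/eqP->|]; last first.
    case/or4P=> /eqP->; split; move: hA hB hA' hB'; clear; lia.
    all: split; clear; lia.
all: split; clear; lia.
Qed.

(** The large literals are digit strings under [Nat.of_num_uint]; unfolding only the accumulator
    leaves Horner expressions that [lia] handles without unary numerals. *)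
Lemma large_quotients :
  [/\ 123656%N = (104 * 1189)%N, 87438%N = (78 * 1121)%N,
    298532%N = (52 * (28 * 205 + 1))%N & 211094%N = (46 * 4589)%N].
Proof.
rewrite /Nat.of_num_uint /Nat.of_uint; cbv [Nat.of_uint_acc].
by rewrite !Nat.tail_mul_spec; split; lia.
Qed.

Lemma pcf12_quotient_eq (R : realType) (p q x y : int) :
  zroot2 R x y * (zbeta R ^+ 2 - zroot2 R p q ^+ 2) = 2 * zroot2 R p q <->
  x * (2 - p * p - 2 * (q * q)) + 2 * (y * (1 - 2 * (p * q))) = 2 * p /\
  x * (1 - 2 * (p * q)) + y * (2 - p * p - 2 * (q * q)) = 2 * q.
Proof.
have -> : zbeta R ^+ 2 - zroot2 R p q ^+ 2 = zroot2 R (2 - p * p - 2 * (q * q)) (1 - 2 * (p * q)).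
  by rewrite !expr2 sqr_zbeta !(zroot2M, zroot2N, zroot2D); congr zroot2; ring.
have -> : 2 * zroot2 R p q = zroot2 R (2 * p) (2 * q).
  by rewrite [in LHS](_ : 2 = zroot2 R 2 0); [rewrite zroot2M; congr zroot2; ring|rewrite /zroot2 mul0r addr0].
rewrite zroot2M; split=> [/zroot2_inj//|[h1 h2]].
by rewrite h1 h2.
Qed.

Lemma zroot2_gt0 (R : realType) p q : 0 < 29 * p + 41 * q -> 0 <= q -> 0 < zroot2 R p q.
Proof.
move=> h q0; have s1 : 41 <= 29 * Num.sqrt 2 :> R.
  have := sqr_sqrt2 R; have := sqrtr_ge0 (2 : R); move: (Num.sqrt _) => s s0 ss; nra.
have h' : 0 < 29 * p%:~R + 41 * q%:~R :> R.
  by rewrite -[29]/(29%:~R) -[41]/(41%:~R) -!intrM -intrD ltr0z.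
have q0' : 0 <= q%:~R :> R by rewrite ler0z.
rewrite /zroot2; move: q0' h' s1.
by move: (p%:~R) (q%:~R) (Num.sqrt _) => x y s y0 h' s1; nra.
Qed.

Lemma pcf12_real (R : realType) (b a1 a2 : R) :
  pcf12 b%:C a1%:C a2%:C = (fun i => (pcf12_seq b a1 a2 i)%:C).
Proof. by apply/funext => n; rewrite /pcf12 /pcf12_seq; do 2 case: ifP => //. Qed.

Lemma card_eq_set_seq (T : choiceType) (s : seq T) : uniq s -> ([set` s] #= `I_(size s))%card.
Proof.
move=> us; have -> : [set` s] = [set` [fset x in s]%fset].
  by apply/seteqP; split=> x /=; rewrite inE.
by apply/card_eq_fsetP; rewrite card_fseq undup_id.
Qed.

Theorem corollary8p19 (R : realType) :
  let z := zsqrt2 R in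
  let S := Zsqrt2_PCF12 (sqrtC (2 + sqrtC 2) : R[i]) in
  (S #= `I_10)%card /\
  S = [set` [::
    (z 1 1, z (-2) 0, z 2 2);
    (z 1 0, z (-2) 2, z 2 0);
    (z (-1) 2, z 26 18, z (-2) 4);
    (z 5 3, z 62 (-44), z 10 6);
    (z 0 1, z 2 0, z 0 2);
    (z 2 1, z 2 (-2), z 4 2);
    (z 2 0, z (-4) (-2), z 4 0);
    (z 2 2, z 8 (-6), z 4 4);
    (z (-182) 130, z (- 123656%N%:R) (- 87438%N%:R), z (-364) 260);
    (z 442 312, z (- 298532%N%:R) 211094%N%:R, z 884 624)]].
Proof.
move=> z S; set s := [:: _; _ ; _; _; _; _; _; _; _; _].
pose F (t : (int * int) * (int * int) * (int * int)) : R[i] * R[i] * R[i] :=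
  (z t.1.1.1 t.1.1.2, z t.1.2.1 t.1.2.2, z t.2.1 t.2.2).
pose T := pcf12_table (- 123656%N%:R) (- 87438%N%:R) (- 298532%N%:R) 211094%N%:R.
have sE : s = map F T by [].
have Teq t : t \in T -> pcf12_eqs t.
  have [e1 e2 e3 e4] := large_quotients.
  apply: pcf12_table_eqs.
  - by rewrite e1 natrM.
  - by rewrite e2 natrM.
  - by rewrite e3 natrM natrD natrM.
  - by rewrite e4 natrM.
have Tsol : map (fun t => t.1.1) T = zsqrt2_sol by [].
have zE m n : z m n = (zroot2 R m n)%:C by exact: zroot2E.
have z_inj : injective (fun t : int * int => z t.1 t.2).
  by move=> [m n] [m' n'] /=; rewrite !zE => -[/zroot2_inj[-> ->]].
have sS : S = [set` s].
  apply/seteqP; split=> -[[b a1] a2].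
    case=> -[p [q ->]] [x [y ->]] [u [v ->]]; rewrite zbetaE !zroot2E pcf12_real.
    case/pcf12_zbeta => a2b hb b0; have [h1 h2] := (pcf12_quotient_eq R p q x y).1 hb.
    have nz : (p, q) != (0, 0).
      by apply: contraTneq b0 => -[-> ->]; rewrite /zroot2 mul0r addr0 ltxx.
    (* All listed heads are positive, so the alternative in which [(- p, - q)] is listed contradicts
       [b > 0]. *)
    have sol_pos p' q' : (p', q') \in zsqrt2_sol -> 0 < zroot2 R p' q'.
      by rewrite -Tsol => /mapP[[[[p1 q1] [x1 y1]] [u1 v1]] /Teq[_ _ _ []] + + [-> ->]] => *; apply: zroot2_gt0.
    have [|/sol_pos] := pcf_equations_sol nz h1 h2; last first.
      by rewrite -zroot2N oppr_gt0 ltNge ltW.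
    rewrite -Tsol => /mapP[[[[p1 q1] [x1 y1]] [u1 v1]] tT [pE qE]].
    have {}pE : p = p1 := pE; have {}qE : q = q1 := qE; subst p1 q1.
    have [[u1E v1E] h1' h2' _] := Teq _ tT.
    rewrite sE; apply/mapP; eexists; first exact: tT.
    rewrite /F /= !zE; congr ((_, _%:C), _%:C).
      have hb' : zroot2 R x1 y1 * (zbeta R ^+ 2 - zroot2 R p q ^+ 2) = 2 * zroot2 R p q.
        exact: (pcf12_quotient_eq R p q x1 y1).2 (conj h1' h2').
      have d0 : zbeta R ^+ 2 - zroot2 R p q ^+ 2 != 0.
        apply: contraTneq b0 => d0; move: hb; rewrite d0 mulr0 => /eqP.
        by rewrite eq_sym mulf_eq0 pnatr_eq0 /= => /eqP ->; rewrite ltxx.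
      by apply: (mulIf d0); rewrite hb.
    rewrite a2b u1E v1E /zroot2 !intrM; ring.
  rewrite /= sE => /mapP[[[[p q] [x y]] [u v]] tT]; rewrite /F /= => -[-> -> ->].
  have [[uE vE] h1 h2 [pos q0]] := Teq _ tT.
  split; [by exists p, q|by exists x, y|by exists u, v|].
  rewrite zbetaE !zE pcf12_real; apply/pcf12_zbeta; split.
  - by rewrite uE vE /zroot2 !intrM; ring.
  - exact: (pcf12_quotient_eq R p q x y).2 (conj h1 h2).
  - exact: zroot2_gt0.
split; last exact: sS.
rewrite sS; have us : uniq s.
  apply: (@map_uniq _ _ (fun t => t.1.1)).
  have -> : map (fun t => t.1.1) s = map (fun t : int * int => z t.1 t.2) zsqrt2_sol by [].
  by rewrite map_inj_uniq //; vm_compute.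
exact: (card_eq_set_seq us).
Qed.
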